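(* Let $G$ be a $\{2,3,5\}'$-group such that $\langle a,b,x\rangle$ is nilpotent for all $a,b\in R_4(G)$ and any $x\in G$. Then $R_4(G)$ is a subgroup of $G$.
   Context: For elements $a,b$ of a group, define the $n$-Engel commutators inductively by $[a,_0 b]:=a$, $[a,_1 b]=[a,b]:=a^{-1}b^{-1}ab$, and $[a,_n b]:=[[a,_{n-1}b],b]$ for all $n>0$. An element $x$ of a group $G$ is called right $n$-Engel if $[x,_n g]=1$ for all $g\in G$; $R_n(G)$ denotes the set of all right $n$-Engel elements of $G$. A $\{2,3,5\}'$-group is a group (not necessarily finite or periodic) having no elements of order $2$, $3$ or $5$. $\langle a,b,x\rangle$ denotes the subgroup generated by $a,b,x$. *)

(* Defs.v *)
From HB Require Import structures.
From mathcomp Require Import all_boot all_classical.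

Set Implicit Arguments.
Unset Strict Implicit.
Unset Printing Implicit Defensive.

Local Open Scope classical_set_scope.
Local Open Scope group_scope.

(* Groups are arbitrary, possibly infinite (groupType, not finGroupType), and
   their subsets are classical sets. *)

Definition is_subgroup (G : groupType) (H : set G) : Prop :=
  [/\ H 1, (forall x y, H x -> H y -> H (x * y)) & (forall x, H x -> H x^-1)].

Definition gen (G : groupType) (A : set G) : set G := smallest (@is_subgroup G) A.

Definition commutator_subgroup (G : groupType) (A B : set G) : set G :=
  gen [set z | exists x y, [/\ A x, B y & z = [~ x, y]]].

(* Indexed from 0: this is gamma_{n+1}(H). *)
Definition lower_central (G : groupType) (H : set G) (n : nat) : set G :=
  iter n (fun K => commutator_subgroup K H) H.

Definition nilpotent_subgroup (G : groupType) (H : set G) : Prop :=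
  is_subgroup H /\ exists n, lower_central H n = [set 1].

Definition has_order (G : groupType) (x : G) (n : nat) : Prop :=
  [/\ (0 < n)%N, x ^+ n = 1 & forall m, (0 < m < n)%N -> x ^+ m <> 1].

(* Elements of infinite order are allowed. *)
Definition prime_to_group (pi : seq nat) (G : groupType) : Prop :=
  forall (p : nat) (x : G), p \in pi -> ~ has_order x p.

(* MathComp's [~ a, b] is a^-1 * (b^-1 * (a * b)). *)
Definition engel_commutator (G : groupType) (a : G) (n : nat) (b : G) : G :=
  iter n (fun c => [~ c, b]) a.

Definition right_engel (n : nat) (G : groupType) : set G :=
  [set x | forall g : G, engel_commutator x n g = 1].
Arguments right_engel n G : clear implicits.

(* Main.v *)
(** Let [N(d, w)] be the subgroup of [<a, b, x>] generated by the commutators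
    in [a, b, x] with at least [d] entries from [{a, b}] and at least [w]
    entries [x].  The commutators [[ab,_4 x]] and [[a^-1,_4 x]] lie in [N(1, 4)], so
    it suffices that [N(1, 4) = 1].  As [N(d, w) = 1] for large [d + w] and there
    is no torsion at 2, 3 and 5, by descending induction on [d + w] it is
    enough to kill a power of 30 times each quotient of [N(d, w)],
    [d >= 1], [w >= 4], by its terms of higher degree.

    These quotients form a Lie ring in which linearising [[a,_4 g] = 1] over
    the products [g] of subsets of [{z1, z2, z3, z4}] gives the identity
    [sum_s [u, z_s1, z_s2, z_s3, z_s4] = 0] for [u] in the ideal generated by [a] and
    [b].  Over [Z[1/30]] this identity makes every Lie word with at least four
    [x] vanish, by induction on the number [l] of its other letters (elements of
    the ideal).  Modulo words with fewer letters, adjacent letters commute, so a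
    word becomes [y x A x B x C x] with [A], [B], [C] products of letters; the
    identity gives [|A|, |C| <= 2] and [|B| <= 3], hence [l <= 8], and the
    finitely many remaining shapes are settled by explicit linear combinations
    of instances of the identity. *)

From HB Require Import structures.
Require Import Defs.
From mathcomp Require Import all_boot all_order all_algebra boolp.
From mathcomp Require Import generic_quotient zify.

Set Implicit Arguments.
Unset Strict Implicit.
Unset Printing Implicit Defensive.

Import GRing.Theory.

Local Open Scope group_scope.

(** * Filtrations by multidegree *)

(** Only [a] and [b] are assumed right Engel; nothing of the kind is known for their commutators, so
    the group identity cannot be linearised at a general element of the ideal. The linearised
    identity, however, is stable under bracketing with any [h]: commutation with [h] is a
    derivation, and for each position the correction terms form another instance, with one [z_i]
    replaced by [[z_i, h]]. This carries it from the generators to the whole ideal. The induction on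
    the number of letters works because the bracket of two letters, or of a letter and [x], is again
    one letter. The primes 2 and 3 come from counting arrangements, 24 of four letters or 6 with one
    end fixed; 5 enters only through the certificates for the small shapes. The quotients of the
    filtration may have torsion even though the group has none at 2, 3 and 5. Hence the Lie ring is
    taken modulo its 30-power torsion, and the hypothesis on the group itself serves only in the
    final descent. *)

Ltac group_norm :=
  rewrite /commg /conjg ?(invgM, invgK, invg1) -?mulgA
    ?(mulKg, mulVKg, mulgV, mulVg, mulg1, mul1g, invg1).

Section CommutatorIdentities.
Variable G : groupType.
Implicit Types f g h z : G.

Lemma commMg g h z : [~ g * h, z] = [~ g, z] ^ h * [~ h, z].
Proof. by group_norm. Qed.

Lemma commgM z g h : [~ z, g * h] = [~ z, h] * [~ z, g] ^ h.
Proof. by group_norm. Qed.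

Lemma commMg_err g h z :
  [~ g * h, z] = [~ g, z] * [~ [~ g, z], h] * [~ h, z].
Proof. by group_norm. Qed.

Lemma commgM_err z g h :
  [~ z, g * h] = [~ z, h] * [~ z, g] * [~ [~ z, g], h].
Proof. by group_norm. Qed.

Lemma commVg_err g z : [~ g^-1, z] = [~ g, z]^-1 ^ g^-1.
Proof. by group_norm. Qed.

Lemma conjg_comm g h : g ^ h = g * [~ g, h].
Proof. by group_norm. Qed.

Lemma Hall_Witt f g h :
  [~ [~ f, g^-1], h] ^ g * [~ [~ g, h^-1], f] ^ h * [~ [~ h, f^-1], g] ^ f = 1.
Proof. by group_norm. Qed.

End CommutatorIdentities.

Section Filtration.
Variables (G : groupType) (J : finType) (gens : J -> G -> Prop).
Implicit Types (m n : J -> nat) (g h : G).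

Definition addm m n : J -> nat := fun j => (m j + n j)%N.
Definition unitm (j : J) : J -> nat := fun i => (i == j).
Definition lem m n := forall j, (m j <= n j)%N.
Definition nzm m := exists j, (0 < m j)%N.
Definition ltm m n := lem m n /\ exists j, (m j < n j)%N.

(* Degree 0 is excluded: commuting with any element of the filtration strictly
   raises the degree. *)
Inductive filt : (J -> nat) -> G -> Prop :=
| filt_gen j g : gens j g -> filt (unitm j) g
| filt_one m : nzm m -> filt m 1
| filt_mul m g h : filt m g -> filt m h -> filt m (g * h)
| filt_inv m g : filt m g -> filt m g^-1
| filt_comm m n g h : filt m g -> filt n h -> filt (addm m n) [~ g, h]
| filt_le m n g : filt m g -> nzm n -> lem n m -> filt n g.

Lemma lem_refl m : lem m m. Proof. by []. Qed.
Lemma lem_trans n m p : lem m n -> lem n p -> lem m p.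
Proof. by move=> h1 h2 j; apply: leq_trans (h2 j). Qed.
Lemma lem_addr m n : lem m (addm m n). Proof. by move=> j; apply: leq_addr. Qed.
Lemma lem_addl m n : lem n (addm m n). Proof. by move=> j; apply: leq_addl. Qed.
Lemma lem_add m n m' n' : lem m m' -> lem n n' -> lem (addm m n) (addm m' n').
Proof. by move=> h1 h2 j; apply: leq_add. Qed.
Lemma nzm_le m n : nzm m -> lem m n -> nzm n.
Proof. by move=> [j hj] h; exists j; apply: leq_trans (h j). Qed.
Lemma ltm_le m n : ltm m n -> lem m n. Proof. by case. Qed.
Lemma ltm_addr m n : nzm n -> ltm m (addm m n).
Proof.
by move=> [j hj]; split; [apply: lem_addr | exists j; rewrite -addn1 leq_add2l].
Qed.
Lemma lt_le_trans n m p : ltm m n -> lem n p -> ltm m p.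
Proof.
move=> [h1 [j hj]] h2; split; first exact: lem_trans h2.
by exists j; apply: leq_trans (h2 j).
Qed.
Lemma le_lt_trans n m p : lem m n -> ltm n p -> ltm m p.
Proof.
move=> h1 [h2 [j hj]]; split; first exact: lem_trans h2.
by exists j; apply: leq_ltn_trans (h1 j) hj.
Qed.
Lemma addmC m n : addm m n = addm n m.
Proof. by apply/funext => j; apply: addnC. Qed.
Lemma addmA m n p : addm m (addm n p) = addm (addm m n) p.
Proof. by apply/funext => j; apply: addnA. Qed.
Lemma lt_add m n m' n' : ltm m m' -> lem n n' -> ltm (addm m n) (addm m' n').
Proof.
move=> [h1 [j hj]] h2; split; first exact: lem_add.
by exists j; apply: (leq_add (m1 := (m j).+1)).
Qed.
Lemma lt_addl m n m' n' : lem m m' -> ltm n n' -> ltm (addm m n) (addm m' n').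
Proof. by move=> h1 h2; rewrite (addmC m) (addmC m'); apply: lt_add. Qed.

Lemma filt_nz m g : filt m g -> nzm m.
Proof.
elim=> //= [j g1 _|m1 n g1 h1 _ h _ _]; first by exists j; rewrite /unitm eqxx.
exact: nzm_le h (@lem_addr _ _).
Qed.

Lemma filt_conj m n g h : filt m g -> filt n h -> filt m (g ^ h).
Proof.
move=> hg hh; rewrite conjg_comm; apply: filt_mul => //.
by apply: (filt_le (filt_comm hg hh)); [apply: filt_nz hg | apply: lem_addr].
Qed.

(** The multidegrees strictly above a given one need have no least element. Error terms therefore
    live in the subgroup generated by all the [filt m] with [B m], and [eqmod] is congruence modulo
    it. *)
Inductive nset (B : (J -> nat) -> Prop) : G -> Prop :=
| nset_one : nset B 1
| nset_cons m g h : B m -> filt m g -> nset B h -> nset B (g * h).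

Implicit Types B C D : (J -> nat) -> Prop.

Lemma nset_base B m g : B m -> filt m g -> nset B g.
Proof. by move=> Bm hg; rewrite -(mulg1 g); apply: nset_cons Bm hg _; left. Qed.

Lemma nset_mul B g h : nset B g -> nset B h -> nset B (g * h).
Proof.
move=> hg; elim: hg h => [|m g1 h1 Bm hg1 _ IH] h hh; first by rewrite mul1g.
by rewrite -mulgA; apply: nset_cons Bm hg1 _; apply: IH.
Qed.

Lemma nset_inv B g : nset B g -> nset B g^-1.
Proof.
elim=> [|m g1 h1 Bm hg1 _ IH]; first by rewrite invg1; left.
by rewrite invgM; apply: nset_mul IH _; apply: nset_base Bm _; apply: filt_inv.
Qed.

Lemma nset_exp B g k : nset B g -> nset B (g ^+ k).
Proof.
move=> hg; elim: k => [|k IH]; first by left.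
by rewrite expgS; apply: nset_mul.
Qed.

Lemma nset_sub B C g : (forall m, B m -> C m) -> nset B g -> nset C g.
Proof.
move=> sBC; elim=> [|m g1 h1 Bm hg1 _ IH]; first by left.
exact: nset_cons (sBC _ Bm) hg1 IH.
Qed.

Lemma nset_conj B C g h : nset B g -> nset C h -> nset B (g ^ h).
Proof.
move=> hg hh; elim: hh g hg => [|n h1 h2 _ hh1 _ IH] g hg; first by rewrite conjg1.
rewrite conjgM; apply: IH.
elim: hg => [|m g1 g2 Bm hg1 _ IH]; first by rewrite conj1g; left.
by rewrite conjMg; apply: nset_cons Bm _ IH; apply: filt_conj hg1 hh1.
Qed.

Lemma nset_comm B C D g h :
  (forall m n, B m -> C n -> D (addm m n)) ->
  nset B g -> nset C h -> nset D [~ g, h].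
Proof.
move=> sD hg hh; elim: hg => [|m g1 g2 Bm hg1 hg2 IHg]; first by rewrite comm1g; left.
rewrite commMg; apply: nset_mul IHg; apply: nset_conj hg2.
elim: hh => [|n h1 h2 Cn hh1 hh2 IHh]; first by rewrite commg1; left.
rewrite commgM; apply: nset_mul IHh _; apply: nset_conj hh2.
exact: nset_base (sD _ _ Bm Cn) (filt_comm hg1 hh1).
Qed.

Lemma filt_nset m g : filt m g -> nset (lem m) g.
Proof. exact: nset_base. Qed.

Definition eqmod B g h := nset B (g^-1 * h).

Lemma eqmod_refl B g : eqmod B g g.
Proof. by rewrite /eqmod mulVg; left. Qed.

Lemma eqmod_sym B g h : eqmod B g h -> eqmod B h g.
Proof. by move=> /nset_inv; rewrite invgM invgK. Qed.

Lemma eqmod_trans B g h k : eqmod B g h -> eqmod B h k -> eqmod B g k.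
Proof.
by move=> h1 h2; have := nset_mul h1 h2; rewrite -mulgA mulVKg.
Qed.

Lemma eqmod_mul B C g g' h h' :
  nset C h -> eqmod B g g' -> eqmod B h h' -> eqmod B (g * h) (g' * h').
Proof.
move=> hh hg1 hh1; rewrite /eqmod.
have -> : (g * h)^-1 * (g' * h') = (g^-1 * g') ^ h * (h^-1 * h') by group_norm.
by apply: nset_mul hh1; apply: nset_conj hg1 hh.
Qed.

Lemma eqmod1 B g : eqmod B g 1 <-> nset B g.
Proof.
rewrite /eqmod mulg1; split=> /nset_inv //; by rewrite invgK.
Qed.

Lemma eqmod_nset B g h : eqmod B g h -> nset B g -> nset B h.
Proof. by move=> e hg; rewrite -(mulVKg g h); apply: nset_mul. Qed.

Lemma eqmodM_comm B g h : nset B [~ g, h] -> eqmod B (h * g) (g * h).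
Proof. by rewrite /eqmod => hc; have -> : (h * g)^-1 * (g * h) = [~ g, h] by group_norm. Qed.

Lemma eqmodMr B g h r : nset B r -> g = h * r -> eqmod B h g.
Proof. by move=> hr ->; rewrite /eqmod mulKg. Qed.

Lemma eqmod_comm B C D E g g' h :
  (forall m n, B m -> C n -> D (addm m n)) ->
  nset C h -> nset E g -> eqmod B g g' -> eqmod D [~ g, h] [~ g', h].
Proof.
move=> sD hh hg e; apply: eqmod_sym; rewrite /eqmod.
have -> : g' = (g^-1 * g') ^ g^-1 * g by group_norm.
set r := _ ^ g^-1.
have hr : nset D [~ r, h].
  by apply: nset_comm sD _ (hh); apply: nset_conj e (nset_inv hg).
have -> : [~ r * g, h]^-1 * [~ g, h] = ([~ r, h]^-1) ^ (g * [~ g, h]) by group_norm.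
apply: nset_conj (nset_inv hr) _; apply: nset_mul (hg) _.
have -> : [~ g, h] = g^-1 * g ^ h by [].
by apply: nset_mul; [apply: nset_inv | apply: nset_conj hg hh].
Qed.

End Filtration.

(** * Linearisation of the Engel identity *)

Section Cube.
Variables (G : groupType) (c : nat -> G).

(* The value at [S] is obtained by keeping the variables indexed by [S] and
   setting the others to 1; index 0 stands for the right Engel element. *)
Definition cube := {ffun {set 'I_5} -> G}.
Definition cube_gen (i : nat) : cube :=
  [ffun S : {set 'I_5} => if inord i \in S then c i else 1].
Definition cube_gens (j : 'I_5) (f : cube) : Prop := f = cube_gen j.

Local Notation cfilt := (filt cube_gens).
Local Notation cnset := (nset cube_gens).
Local Notation ceqmod := (eqmod cube_gens).

Definition total (m : 'I_5 -> nat) := (\sum_j m j)%N.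
(** The linearisation aims at [U] full and [n = 6]: with five variables, such a degree is strictly
    above the multilinear one. *)
Definition supp_above (U : {set 'I_5}) (n : nat) (m : 'I_5 -> nat) :=
  (forall j, j \in U -> (0 < m j)%N) /\ (n <= total m)%N.

Lemma total_addm m n : total (addm m n) = (total m + total n)%N.
Proof. by rewrite /total big_split. Qed.
Lemma total_unitm j : total (unitm j) = 1%N.
Proof. by rewrite /total (bigD1 j) //= /unitm eqxx big1 ?addn0 // => i /negPf->. Qed.

Lemma supp_above_add (U U' : {set 'I_5}) n n' m m' :
  supp_above U n m -> supp_above U' n' m' -> supp_above (U :|: U') (n + n') (addm m m').
Proof.
move=> [h1 h2] [h3 h4]; split; last by rewrite total_addm leq_add.
by move=> j /setUP[/h1|/h3] h; rewrite /addm addn_gt0 h ?orbT.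
Qed.

Lemma supp_above_le (U U' : {set 'I_5}) n n' m :
  U' \subset U -> (n' <= n)%N -> supp_above U n m -> supp_above U' n' m.
Proof.
move=> /fintype.subsetP sU le [h1 h2]; split; last exact: leq_trans h2.
by move=> j /sU /h1.
Qed.

Definition face (j : 'I_5) (f : cube) : cube := [ffun S => f (S :\ j)].
(* [diff j] kills the functions that do not involve the variable [j]. *)
Definition diff (j : 'I_5) (f : cube) : cube := (face j f)^-1 * f.

Lemma faceM j f g : face j (f * g) = face j f * face j g.
Proof. by apply/ffunP => S; rewrite !ffunE. Qed.
Lemma faceV j f : face j f^-1 = (face j f)^-1.
Proof. by apply/ffunP => S; rewrite !ffunE. Qed.
Lemma face1 j : face j 1 = 1.
Proof. by apply/ffunP => S; rewrite !ffunE. Qed.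
Lemma faceR j f g : face j [~ f, g] = [~ face j f, face j g].
Proof. by rewrite /commg /conjg !faceM !faceV. Qed.

Lemma diffM j f g : diff j (f * g) = diff j f ^ face j g * diff j g.
Proof. by rewrite /diff faceM; group_norm. Qed.
Lemma diffV j f : diff j f^-1 = ((diff j f)^-1) ^ (face j f)^-1.
Proof. by rewrite /diff faceV; group_norm. Qed.

Lemma face_gen j (i : 'I_5) : face j (cube_gen i) = if i == j then 1 else cube_gen i.
Proof.
apply/ffunP => S; rewrite !ffunE inord_val in_setD1.
by case: eqVneq => [->|_]; rewrite ?ffunE ?inord_val.
Qed.

Lemma filt_face m j f : cfilt m f -> cfilt m (face j f).
Proof.
elim=> [i g ->|m1 nz|m1 g h _ IHg _ IHh|m1 g _ IHg|m1 n g h _ IHg _ IHh|m1 n g _ IH nz le].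
- rewrite face_gen; case: eqP => _; last exact: filt_gen.
  by apply: filt_one; exists i; rewrite /unitm eqxx.
- by rewrite face1; apply: filt_one.
- by rewrite faceM; apply: filt_mul.
- by rewrite faceV; apply: filt_inv.
- by rewrite faceR; apply: filt_comm.
- exact: filt_le IH nz le.
Qed.

Definition maxm (m : 'I_5 -> nat) j : 'I_5 -> nat := fun i => maxn (m i) (i == j).

Lemma lem_maxm m j : lem m (maxm m j). Proof. by move=> i; apply: leq_maxl. Qed.
Lemma nzm_maxm m j : nzm (maxm m j).
Proof. by exists j; rewrite /maxm eqxx leq_maxr. Qed.
Lemma maxm_addl m n j : lem (maxm (addm m n) j) (addm (maxm m j) n).
Proof.
move=> i; rewrite /maxm /addm geq_max leq_add2r leq_maxl /=.
by apply: leq_trans (leq_addr _ _); apply: leq_maxr.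
Qed.
Lemma maxm_addr m n j : lem (maxm (addm m n) j) (addm m (maxm n j)).
Proof. by rewrite addmC (addmC m); apply: maxm_addl. Qed.

(** Whatever survives the comparison with the face [j] involves the variable [j], without losing any
    other part of its degree. This is the group form of polarisation. *)
Lemma filt_diff m j f : cfilt m f -> cfilt (maxm m j) (diff j f).
Proof.
elim=> [i g ->|m1 nz|m1 g h _ IHg hh IHh|m1 g hg IHg|m1 n g h hg IHg hh IHh|m1 n g _ IH nz le].
- rewrite /diff face_gen; case: eqP => [->|_]; last first.
    by rewrite mulVg; apply/filt_one/nzm_maxm.
  rewrite invg1 mul1g; have -> : maxm (unitm j) j = unitm j.
    by apply/funext => k; rewrite /maxm /unitm maxnn.
  exact: filt_gen.
- by rewrite /diff face1 mulVg; apply/filt_one/nzm_maxm.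
- rewrite diffM; apply: filt_mul => //.
  by apply: filt_conj IHg _; apply: filt_face hh.
- rewrite diffV; apply: filt_conj (filt_inv (filt_face j hg)).
  exact: filt_inv.
- set f0 := face j g; set g0 := face j h; set r := diff j g; set s := diff j h.
  have eg : g = f0 * r by rewrite /r /diff mulVKg.
  have eh : h = g0 * s by rewrite /s /diff mulVKg.
  have Hf0 : cfilt m1 f0 by apply: filt_face.
  have Hg0 : cfilt n g0 by apply: filt_face.
  (* Expanding [[~ f0 * r, g0 * s]], the only commutator free of [r] and [s] is [[~ f0, g0]], and it
     cancels against the face up to a conjugation. *)
  have -> : diff j [~ g, h] =
     [~ f0, s] ^ [~ f0, g0] * [~ [~ f0, g0], s] * ([~ [~ f0, h], r] * [~ r, h]).
    by rewrite /diff faceR -/f0 -/g0 {1}eg commMg_err {1}eh commgM_err conjgE !mulgA.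
  have le1 k k' u : cfilt (addm k (maxm k' j)) u -> lem m1 k -> lem n k' ->
      cfilt (maxm (addm m1 n) j) u.
    move=> hu l1 l2; apply: filt_le hu (nzm_maxm _ _) _.
    apply: lem_trans (maxm_addr _ _ _) _; apply: lem_add => // i.
    by rewrite /maxm geq_max leq_maxr andbT; apply: leq_trans (l2 i) (leq_maxl _ _).
  have le2 k k' u : cfilt (addm (maxm k j) k') u -> lem m1 k -> lem n k' ->
      cfilt (maxm (addm m1 n) j) u.
    move=> hu l1 l2; apply: filt_le hu (nzm_maxm _ _) _.
    apply: lem_trans (maxm_addl _ _ _) _; apply: lem_add => // i.
    by rewrite /maxm geq_max leq_maxr andbT; apply: leq_trans (l1 i) (leq_maxl _ _).
  apply: filt_mul; apply: filt_mul.
  + by apply: filt_conj (filt_comm Hf0 Hg0); apply: (le1 m1 n) => //; apply: filt_comm.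
  + apply: (le1 (addm m1 n) n) => //; last exact: lem_addr.
    by apply: filt_comm => //; apply: filt_comm.
  + apply: (le2 m1 (addm m1 n)) => //; last exact: lem_addl.
    by rewrite addmC; apply: filt_comm => //; apply: filt_comm.
  + by apply: (le2 m1 n) => //; apply: filt_comm.
- apply: filt_le IH (nzm_maxm _ _) _ => i.
  by rewrite /maxm geq_max leq_maxr andbT; apply: leq_trans (le i) (leq_maxl _ _).
Qed.

Lemma nset_face B j f : cnset B f -> cnset B (face j f).
Proof.
elim=> [|m g h Bm hg _ IH]; first by rewrite face1; left.
by rewrite faceM; apply: nset_cons Bm (filt_face j hg) IH.
Qed.

Lemma nset_diff U n j f :
  cnset (supp_above U n) f -> cnset (supp_above (j |: U) n) (diff j f).
Proof.
elim=> [|m g h [Bm1 Bm2] hg hh IH]; first by rewrite /diff face1 mulVg; left.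
rewrite diffM; apply: nset_mul IH; apply: nset_conj (nset_face j hh).
apply: nset_base (filt_diff j hg); split; last first.
  by apply: leq_trans Bm2 _; apply: leq_sum => i _; apply: lem_maxm.
move=> i /setU1P[->|/Bm1 h0]; first by rewrite /maxm eqxx leq_maxr.
by apply: leq_trans h0 (lem_maxm _ _ _).
Qed.

Definition cube_comm (t : seq nat) : cube := foldl (fun f i => [~ f, cube_gen i]) (cube_gen 0) t.
Definition index_words (k : nat) : seq (seq nat) :=
  iter k (fun ws => [seq rcons t i | t <- ws, i <- iota 1 4]) [:: [::]].

Local Notation W U n := (supp_above U n).
Local Notation S0 := [set ord0 : 'I_5].

Lemma nset_cube_gen i : (i < 5)%N -> cnset (W [set inord i] 1) (cube_gen i).
Proof.
move=> hi; apply: (@nset_base _ _ _ _ (unitm (inord i))).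
  by split; rewrite ?total_unitm // => j /set1P->; rewrite /unitm eqxx.
by apply: filt_gen; rewrite /cube_gens inordK.
Qed.

Definition index_supp (t : seq nat) : {set 'I_5} := [set j : 'I_5 | val j \in 0%N :: t].

Lemma nset_cube_comm t : all (fun i => i < 5)%N t ->
  cnset (W (index_supp t) (size t).+1) (cube_comm t).
Proof.
elim/last_ind: t => [|t i IH] /=.
  move=> _; apply: nset_sub (@nset_cube_gen 0 isT) => m.
  apply: supp_above_le => //; apply/fintype.subsetP => j.
  by rewrite !inE => /eqP j0; apply/eqP/val_inj; rewrite /= inordK.
rewrite all_rcons => /andP[hi /IH ht]; rewrite /cube_comm foldl_rcons size_rcons.
apply: nset_comm ht (nset_cube_gen hi) => m n hm hn.
apply: supp_above_le (supp_above_add hm hn); last by rewrite addn1.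
apply/fintype.subsetP => j; rewrite !inE mem_rcons inE orbCA => /orP[/eqP ji|->//].
by apply/orP; right; apply/eqP/val_inj; rewrite /= inordK.
Qed.

Lemma nset_cube_prod s : all (fun i => i < 5)%N s ->
  cnset (W set0 1) (\prod_(i <- s) cube_gen i).
Proof.
elim: s => [|i s IH] /=; first by rewrite big_nil; left.
move=> /andP[hi hs]; rewrite big_cons; apply: nset_mul (IH hs).
by apply: nset_sub (nset_cube_gen hi) => m; apply: supp_above_le => //; apply: sub0set.
Qed.

Lemma swap_mod U n f g : (0 < n)%N -> cnset (W U n) f -> cnset (W U n) g ->
  ceqmod (W U n.+1) (f * g) (g * f).
Proof.
move=> n0 hf hg; apply: eqmodM_comm; apply: nset_comm hg hf => m m' hm hm'.
apply: supp_above_le (supp_above_add hm hm'); first by rewrite setUid.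
by rewrite -addn1 leq_add2l.
Qed.

Lemma nset_step U U' n k f g : cnset (W U n) f -> cnset (W U' k) g ->
  cnset (W U (n + k)) [~ f, g].
Proof.
move=> hf hg; apply: nset_comm hf hg => m m' hm hm'.
by apply: supp_above_le (supp_above_add hm hm') => //; apply: subsetUl.
Qed.

Lemma comm_prod_r U n g s : (0 < n)%N -> all (fun i => i < 5)%N s -> cnset (W U n) g ->
  ceqmod (W U n.+2) [~ g, \prod_(i <- s) cube_gen i] (\prod_(i <- s) [~ g, cube_gen i]).
Proof.
move=> n0 + hg; elim: s => [|i s IH] /=.
  by rewrite !big_nil commg1 => _; apply: eqmod_refl.
move=> /andP[hi hs]; rewrite !big_cons.
have h1 : cnset (W U n.+1) [~ g, cube_gen i].
  by rewrite -(addn1 n); apply: nset_step hg (nset_cube_gen hi).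
have h2 : cnset (W U n.+1) [~ g, \prod_(i <- s) cube_gen i].
  by rewrite -(addn1 n); apply: nset_step hg (nset_cube_prod hs).
have h3 : cnset (W U n.+2) [~ [~ g, cube_gen i], \prod_(i <- s) cube_gen i].
  by rewrite -(addn1 n.+1); apply: nset_step h1 (nset_cube_prod hs).
apply: eqmod_trans (eqmod_sym (eqmodMr h3 (commgM_err _ _ _))) _.
apply: eqmod_trans (swap_mod _ h2 h1) _ => //.
by apply: eqmod_mul h2 (eqmod_refl _ _ _) (IH hs).
Qed.

Lemma comm_prod_l (T : Type) U n z (s : seq T) (F : T -> cube) (P : pred T) :
  (0 < n)%N -> all P s -> (forall x, P x -> cnset (W U n) (F x)) -> cnset (W set0 1) z ->
  ceqmod (W U n.+2) [~ \prod_(x <- s) F x, z] (\prod_(x <- s) [~ F x, z]).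
Proof.
move=> n0 + hF hz; elim: s => [|x s IH] /=.
  by rewrite !big_nil comm1g => _; apply: eqmod_refl.
move=> /andP[/hF hx hs]; rewrite !big_cons commMg conjg_comm.
have hs' : cnset (W U n) (\prod_(x <- s) F x).
  elim: s hs {IH} => [|y s IH] /=; first by rewrite big_nil; left.
  by move=> /andP[/hF hy /IH hs]; rewrite big_cons; apply: nset_mul.
have h1 : cnset (W U n.+1) [~ F x, z] by rewrite -(addn1 n); apply: nset_step hx hz.
have h2 : cnset (W U n.+1) [~ \prod_(x <- s) F x, z].
  by rewrite -(addn1 n); apply: nset_step hs' hz.
apply: eqmod_mul h2 _ (IH hs); apply: eqmod_sym; apply: eqmodMr _ erefl.
apply: nset_sub (nset_step h1 hs') => m; apply: supp_above_le => //.
by rewrite addSn -addn2 addnS ltnS leq_add2l.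
Qed.

Lemma nset_prod (T : Type) B (s : seq T) (F : T -> cube) (P : pred T) :
  all P s -> (forall x, P x -> cnset B (F x)) -> cnset B (\prod_(x <- s) F x).
Proof.
move=> + hF; elim: s => [|x s IH] /=; first by rewrite big_nil; left.
by move=> /andP[/hF hx /IH hs]; rewrite big_cons; apply: nset_mul.
Qed.

Lemma eqmod_prod (T : Type) B C (s : seq T) (F F' : T -> cube) (P : pred T) :
  all P s -> (forall x, P x -> cnset C (F x)) ->
  (forall x, P x -> ceqmod B (F x) (F' x)) ->
  ceqmod B (\prod_(x <- s) F x) (\prod_(x <- s) F' x).
Proof.
move=> + hF hFF; elim: s => [|x s IH] /=; first by rewrite !big_nil => _; apply: eqmod_refl.
move=> /andP[hx hs]; rewrite !big_cons; apply: eqmod_mul (hFF _ hx) (IH hs).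
exact: nset_prod hs hF.
Qed.

Definition good_index k (t : seq nat) := (size t == k) && all (fun i => i < 5)%N t.

Lemma index_words_good k : all (good_index k) (index_words k).
Proof.
elim: k => // k IH; apply/allP => t /allpairsP[[u i] /= [hu hi ->]].
move/allP: IH => /(_ u hu) /andP[/eqP su au].
rewrite /good_index size_rcons su eqxx all_rcons au andbT /=.
by move: hi; rewrite !inE => /or4P[]/eqP->.
Qed.

(** Commutation is additive in both arguments up to terms of higher total degree. The variable 0
    stays in the support because every term descends from [cube_gen 0]. *)
Lemma cube_expand k :
  ceqmod (W S0 k.+2) (iter k (fun f => [~ f, \prod_(i <- iota 1 4) cube_gen i]) (cube_gen 0))
    (\prod_(t <- index_words k) cube_comm t).
Proof.
have hZ : cnset (W set0 1) (\prod_(i <- iota 1 4) cube_gen i) by apply: nset_cube_prod.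
have hT n t : good_index n t -> cnset (W S0 n.+1) (cube_comm t).
  move=> /andP[/eqP <- ht]; apply: nset_sub (nset_cube_comm ht) => m.
  by apply: supp_above_le => //; apply/fintype.subsetP => j; rewrite !inE => /eqP->.
elim: k => [|k IH].
  by rewrite /= big_cons big_nil mulg1; apply: eqmod_refl.
rewrite iterS; set f := iter k _ _ in IH *.
have hf : cnset (W S0 k.+1) f.
  rewrite /f; elim: k {IH f} => [|k IH] /=; first exact: hT 0%N [::] isT.
  by rewrite -(addn1 k.+1); apply: nset_step IH hZ.
apply: eqmod_trans (eqmod_comm _ hZ hf IH) _.
  move=> m n hm hn; apply: supp_above_le (supp_above_add hm hn) => //.
    by rewrite setU0.
  by rewrite addn1.
apply: eqmod_trans (comm_prod_l _ (index_words_good k) _ hZ) _ => //; first exact: hT.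
have -> : \prod_(t <- index_words k.+1) cube_comm t =
    \prod_(t <- index_words k) \prod_(i <- iota 1 4) [~ cube_comm t, cube_gen i].
  rewrite /index_words iterS -/(index_words k) big_allpairs_dep /=.
  by apply: eq_bigr => t _; apply: eq_bigr => i _; rewrite /cube_comm foldl_rcons.
apply: (eqmod_prod (index_words_good k) (C := W S0 k.+2)) => t ht.
  by rewrite -(addn1 k.+1); apply: nset_step (hT _ _ ht) hZ.
by apply: comm_prod_r => //; apply: hT.
Qed.

Lemma diff_prod (T : Type) U n j (s : seq T) (F : T -> cube) (P : pred T) :
  (0 < n)%N -> all P s -> (forall x, P x -> cnset (W U n) (F x)) ->
  ceqmod (W (j |: U) n.+1) (diff j (\prod_(x <- s) F x)) (\prod_(x <- s) diff j (F x)).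
Proof.
move=> n0 + hF; elim: s => [|x s IH] /=.
  by rewrite !big_nil /diff face1 mulVg => _; apply: eqmod_refl.
move=> /andP[/hF hx hs]; rewrite !big_cons diffM conjg_comm.
have hp := nset_prod hs hF.
apply: eqmod_mul (nset_diff j hp) _ (IH hs).
apply: eqmod_sym; apply: eqmodMr _ erefl.
apply: nset_sub (nset_step (nset_diff j hx) (nset_face j hp)) => m.
by apply: supp_above_le => //; rewrite -addn1 leq_add2l.
Qed.

Lemma face_cube_comm j t : all (fun i => i < 5)%N t -> val j \in t -> face j (cube_comm t) = 1.
Proof.
elim/last_ind: t => // t i IH; rewrite all_rcons /cube_comm foldl_rcons => /andP[hi ht].
rewrite mem_rcons inE faceR => /orP[/eqP ji|jt]; last by rewrite (IH ht jt) comm1g.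
by rewrite -[i]/(val (Ordinal hi)) face_gen -val_eqE /= ji eqxx commg1.
Qed.

Lemma face_cube_commN j t : all (fun i => i < 5)%N t -> val j \notin 0%N :: t ->
  face j (cube_comm t) = cube_comm t.
Proof.
elim/last_ind: t => [_|t i IH]; rewrite ?all_rcons /cube_comm ?foldl_rcons /=.
  rewrite inE => j0; have := face_gen j ord0; rewrite /= => ->.
  by rewrite -val_eqE /= eq_sym (negPf j0).
rewrite inE mem_rcons inE !negb_or => /andP[hi ht] /andP[j0 /andP[ji jt]].
rewrite faceR (IH ht) ?inE ?negb_or ?j0 //.
by rewrite -[i]/(val (Ordinal hi)) face_gen -val_eqE /= eq_sym (negPf ji).
Qed.

(** Setting the variable [j] to 1 trivialises the commutators that contain it and fixes the others,
    so the difference selects exactly the former. *)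
Lemma diff_select U n k j (s : seq (seq nat)) : (0 < n)%N -> (0 < val j)%N ->
  all (good_index k) s -> (forall t, t \in s -> cnset (W U n) (cube_comm t)) ->
  cnset (W U n.+1) (\prod_(t <- s) cube_comm t) ->
  cnset (W (j |: U) n.+1) (\prod_(t <- [seq t <- s | val j \in t]) cube_comm t).
Proof.
move=> n0 j0 hs hF h.
have hs' : all (mem s) s by apply/allP.
have := eqmod_nset (diff_prod j n0 hs' hF) (nset_diff j h).
suff -> : \prod_(x <- s) diff j (cube_comm x) =
   \prod_(t <- [seq t <- s | val j \in t]) cube_comm t by [].
rewrite big_filter [RHS]big_mkcond big_seq [RHS]big_seq; apply: eq_bigr => t.
move=> /(allP hs) /andP[_ ht]; rewrite /diff; case: ifP => jt.
  by rewrite face_cube_comm // invg1 mul1g.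
by rewrite face_cube_commN ?mulVg // inE negb_or -lt0n j0 jt.
Qed.

(* The 24 arrangements of 1, 2, 3, 4. *)
Definition perms4 : seq (seq nat) :=
  [seq t <- [seq t <- [seq t <- [seq t <- index_words 4 | 1%N \in t]
     | 2%N \in t] | 3%N \in t] | 4%N \in t].

(** Differences in the variables 1, 2, 3, 4 in turn leave the words of length 4 in which each of
    them occurs, that is, the arrangements. *)
Lemma cube_engel :
  iter 4 (fun f => [~ f, \prod_(i <- iota 1 4) cube_gen i]) (cube_gen 0) = 1 ->
  cnset (W setT 6) (\prod_(t <- perms4) cube_comm t).
Proof.
move=> h0; have := cube_expand 4; rewrite h0 => /eqmod_sym/eqmod1 h1.
have hg := index_words_good 4.
move: h1 hg; rewrite /perms4; move: (index_words 4) => L h1 hg.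
have step (U : {set 'I_5}) (j : nat) (s : seq (seq nat)) : (0 < j < 5)%N ->
    {subset s <= L} -> (forall t, t \in s -> U \subset index_supp t) ->
    cnset (W U 6) (\prod_(t <- s) cube_comm t) ->
    let s' := [seq t <- s | j \in t] in
    [/\ {subset s' <= L},
      (forall t, t \in s' -> inord j |: U \subset index_supp t) &
      cnset (W (inord j |: U) 6) (\prod_(t <- s') cube_comm t)].
  move=> /andP[j0 j5] hs hU h s'; split.
  - by move=> t; rewrite mem_filter => /andP[_ /hs].
  - move=> t; rewrite mem_filter => /andP[jt /hU sU]; rewrite subUset sU andbT.
    by rewrite sub1set !inE /= inordK // jt orbT.
  have -> : s' = [seq t <- s | val (inord j : 'I_5) \in t] by rewrite /s' /= inordK.
  apply: (@diff_select U 5 4) => //; first by rewrite /= inordK.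
    by apply/allP => t /hs; apply: (allP hg).
  move=> t ts; have /andP[/eqP s4 ht] := allP hg t (hs t ts).
  have := nset_cube_comm ht; rewrite s4; apply: nset_sub => m.
  by apply: supp_above_le => //; apply: hU.
have hS0 t : t \in L -> S0 \subset index_supp t by rewrite sub1set inE.
have [a1 b1 c1] := step S0 1%N L isT (fun t h => h) hS0 h1.
have [a2 b2 c2] := step _ 2%N _ isT a1 b1 c1.
have [a3 b3 c3] := step _ 3%N _ isT a2 b2 c2.
have [_ _ c4] := step _ 4%N _ isT a3 b3 c3.
apply: nset_sub c4 => m.
apply: supp_above_le => //; apply/fintype.subsetP => j _; rewrite !inE -!val_eqE /= !inordK //.
by case: j => -[|[|[|[|[|]]]]].
Qed.

(** * Evaluation of the cube in the filtered group *)

Variables (J : finType) (gens : J -> G -> Prop) (p : nat -> J -> nat).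
Hypothesis filt_c : forall i, (i < 5)%N -> filt gens (p i) (c i).

Definition eval_degree (m : 'I_5 -> nat) : J -> nat :=
  fun k => (\sum_(j < 5) m j * p j k)%N.

Lemma nzm_eval m : nzm m -> nzm (eval_degree m).
Proof.
move=> [j hj]; have [k hk] := filt_nz (filt_c (ltn_ord j)).
by exists k; rewrite /eval_degree (bigD1 j) //= ltn_addr // muln_gt0 hj.
Qed.

Lemma lem_eval m n : lem m n -> lem (eval_degree m) (eval_degree n).
Proof. by move=> h k; apply: leq_sum => j _; rewrite leq_mul2r h orbT. Qed.

Lemma ltm_eval m n : ltm m n -> ltm (eval_degree m) (eval_degree n).
Proof.
move=> [h [j hj]]; split; first exact: lem_eval.
have [k hk] := filt_nz (filt_c (ltn_ord j)).
exists k; rewrite /eval_degree (bigD1 j) //= [X in (_ < X)%N](bigD1 j) //= -addSn leq_add //.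
  by rewrite ltn_mul2r hk.
by apply: leq_sum => i _; rewrite leq_mul2r h orbT.
Qed.

Lemma filt_eval m f (S : {set 'I_5}) : cfilt m f -> filt gens (eval_degree m) (f S).
Proof.
elim=> [j g ->|m1 nz|m1 g h _ IHg _ IHh|m1 g _ IHg|m1 n g h _ IHg _ IHh|m1 n g _ IH nz le].
- have -> : eval_degree (unitm j) = p j.
    apply/funext => k; rewrite /eval_degree (bigD1 j) //= /unitm eqxx mul1n.
    by rewrite big1 ?addn0 // => i /negPf->.
  rewrite ffunE; case: ifP => _; first exact: filt_c.
  by apply/filt_one/(filt_nz (filt_c (ltn_ord j))).
- by rewrite ffunE; apply/filt_one/nzm_eval.
- by rewrite ffunE; apply: filt_mul.
- by rewrite ffunE; apply: filt_inv.
- rewrite /commg /conjg !ffunE.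
  have -> : eval_degree (addm m1 n) = addm (eval_degree m1) (eval_degree n).
    apply/funext => k; rewrite /eval_degree /addm -big_split.
    by apply: eq_bigr => i _; rewrite mulnDl.
  exact: filt_comm.
- by apply: filt_le IH (nzm_eval nz) (lem_eval le).
Qed.

(** The Engel hypothesis holds in the cube entry by entry: the entry at [S] is an Engel commutator
    of [c 0] if [S] contains 0, and starts from 1 otherwise. The congruence obtained there is read
    at the full set. *)
Lemma engel_linearization :
  (forall g, iter 4 (fun f => [~ f, g]) (c 0) = 1) ->
  nset gens (ltm (eval_degree (fun=> 1%N)))
    (\prod_(t <- perms4) foldl (fun f i => [~ f, c i]) (c 0) t).
Proof.
move=> hc; have : cnset (W setT 6) (\prod_(t <- perms4) cube_comm t).
  apply: cube_engel; apply/ffunP => S; rewrite [RHS]ffunE.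
  set z := \prod_(i <- _) _.
  have hR f : ([~ f, z] : cube) S = [~ f S, z S] by rewrite /commg /conjg !ffunE.
  rewrite /= !hR [cube_gen 0 S]ffunE; case: ifP => _; first exact: (hc (z S)).
  by rewrite !comm1g.
have -> : \prod_(t <- perms4) foldl (fun f i => [~ f, c i]) (c 0) t =
    (\prod_(t <- perms4) cube_comm t : cube) setT.
  rewrite (big_morph (fun f : cube => f setT) (id1 := 1) (op1 := *%g)); last by rewrite ffunE.
    apply: eq_bigr => t _; elim/last_ind: t => [|t i IH].
      by rewrite /cube_comm /= ffunE inE.
    rewrite /cube_comm !foldl_rcons -/(cube_comm t) IH /commg /conjg !ffunE inE //.
  by move=> f g; rewrite ffunE.
elim=> [|m f g [Bm1 Bm2] hf _ IH]; first by rewrite ffunE; left.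
rewrite ffunE; apply: nset_cons (ltm_eval _) (filt_eval _ hf) IH; split.
  by move=> j; apply: Bm1; rewrite inE.
(* If no component exceeded 1, the total would be at most 5, against the bound 6. *)
case: (pselect (exists j, (1 < m j)%N)) => // h.
have /(leq_trans Bm2) : (total m <= \sum_(j < 5) 1)%N.
  by apply: leq_sum => j _; rewrite leqNgt; apply/negP => hj; apply: h; exists j.
by rewrite sum1_card card_ord.
Qed.

End Cube.

(** * The graded module modulo torsion *)

Section Graded.
Variables (G : groupType) (J : finType) (gens : J -> G -> Prop) (d0 : J).
Implicit Types (m n p : J -> nat) (g h : G).
Local Notation filt := (filt gens).
Local Notation nset := (nset gens).
Local Notation eqmod := (eqmod gens).

Definition ideal_degree m := (0 < m d0)%N.
Local Notation D := ideal_degree.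

Lemma ideal_degree_nzm m : D m -> nzm m. Proof. by exists d0. Qed.
Lemma ideal_degree_addl m n : D m -> D (addm m n).
Proof. by rewrite /D /addm => h; rewrite ltn_addr. Qed.

Lemma comm_ltm m n g h : filt m g -> filt n h -> nset (ltm m) [~ g, h].
Proof.
move=> hg hh; apply: nset_base (filt_comm hg hh).
exact/ltm_addr/(filt_nz hh).
Qed.

Lemma expM_mod m g h k : filt m g -> filt m h ->
  eqmod (ltm m) ((g * h) ^+ k) (g ^+ k * h ^+ k).
Proof.
move=> hg hh; elim: k => [|k IH]; first by rewrite mulg1; apply: eqmod_refl.
have ng := filt_nset hg; have nh := filt_nset hh.
rewrite !expgS; apply: eqmod_trans (eqmod_mul (nset_exp k (nset_mul ng nh)) (eqmod_refl _ _ _) IH) _.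
rewrite -!mulgA; apply: (eqmod_mul (C := lem m)); last 2 first.
- exact: eqmod_refl.
- rewrite !mulgA; apply: (eqmod_mul (C := lem m)); [exact: nset_exp| |exact: eqmod_refl].
  apply: eqmodM_comm; apply: nset_comm (nset_exp k ng) nh => m1 n1 h1 h2.
  exact: le_lt_trans h1 (ltm_addr _ (nzm_le (filt_nz hh) h2)).
- by apply: nset_mul => //; apply: nset_mul; apply: nset_exp.
Qed.

(* Torsion at 2, 3 and 5 modulo the terms of higher degree. *)
Definition torsion m g := exists k, nset (ltm m) (g ^+ (30 ^ k)).

Lemma exp_add g k l : g ^+ (30 ^ (k + l)) = (g ^+ (30 ^ k)) ^+ (30 ^ l).
Proof. by rewrite expnD expgnA. Qed.

Lemma torsion_ltm m g : nset (ltm m) g -> torsion m g.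
Proof. by exists 0%N; rewrite expg1. Qed.

Lemma torsion_mul m g h : filt m g -> filt m h -> torsion m g -> torsion m h ->
  torsion m (g * h).
Proof.
move=> hg hh [k hk] [l hl]; exists (k + l)%N.
apply: eqmod_nset (eqmod_sym (expM_mod _ hg hh)) _.
by apply: nset_mul; [|rewrite addnC]; rewrite exp_add; apply: nset_exp.
Qed.

Lemma torsion_eqmod m g h : filt m g -> filt m h -> eqmod (ltm m) g h ->
  torsion m g -> torsion m h.
Proof.
move=> hg hh e ht; rewrite -(mulVKg g h); apply: torsion_mul ht (torsion_ltm e) => //.
by apply: filt_mul (filt_inv hg) hh.
Qed.

Lemma torsion_inv m g : torsion m g -> torsion m g^-1.
Proof. by move=> [k hk]; exists k; rewrite expVgn; apply: nset_inv. Qed.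

Lemma torsion_conj m n g h : filt n h -> torsion m g -> torsion m (g ^ h).
Proof.
by move=> hh [k hk]; exists k; rewrite -conjXg; apply: nset_conj hk (filt_nset hh).
Qed.

Lemma commXg_mod m n g h k : D m -> filt m g -> filt n h ->
  eqmod (ltm (addm m n)) [~ g ^+ k, h] ([~ g, h] ^+ k).
Proof.
move=> Dm hg hh; elim: k => [|k IH]; first by rewrite comm1g; apply: eqmod_refl.
rewrite !expgS commMg_err.
have ngh := filt_nset (filt_comm hg hh).
have hgk := nset_exp k (filt_nset hg).
apply: (eqmod_mul (C := lem (addm m n))) => //.
  apply: nset_comm hgk (filt_nset hh) => m1 n1; exact: lem_add.
apply: eqmod_sym; apply: eqmodMr _ erefl.
apply: nset_comm ngh hgk => m1 n1 h1 h2; apply: le_lt_trans h1 _.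
exact/ltm_addr/(nzm_le (ideal_degree_nzm Dm) h2).
Qed.

Lemma torsion_comm m n g h : D m -> filt m g -> filt n h -> torsion m g ->
  torsion (addm m n) [~ g, h].
Proof.
move=> Dm hg hh [k hk]; exists k; apply: eqmod_nset (commXg_mod _ Dm hg hh) _.
by apply: nset_comm hk (filt_nset hh) => m1 n1; apply: lt_add.
Qed.

Lemma commMg_mod m n g1 g2 h : D m -> filt m g1 -> filt m g2 -> filt n h ->
  eqmod (ltm (addm m n)) [~ g1 * g2, h] ([~ g1, h] * [~ g2, h]).
Proof.
move=> Dm hg1 hg2 hh; rewrite commMg_err.
apply: (eqmod_mul (C := lem (addm m n))); [exact/filt_nset/filt_comm| |exact: eqmod_refl].
apply: eqmod_sym; apply: eqmodMr _ erefl.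
exact: comm_ltm (filt_comm hg1 hh) hg2.
Qed.

Lemma commgM_mod m n g h1 h2 : filt m g -> filt n h1 -> filt n h2 ->
  eqmod (ltm (addm m n)) [~ g, h1 * h2] ([~ g, h2] * [~ g, h1]).
Proof.
move=> hg hh1 hh2; rewrite commgM_err; apply: eqmod_sym; apply: eqmodMr _ erefl.
exact: comm_ltm (filt_comm hg hh1) hh2.
Qed.

(** Obtained by expanding both sides of [[~ g, h * z] = [~ g, z * h * [~ h, z]]]; apart from the
    three double commutators, what remains has higher degree. *)
Lemma Jacobi_mod m n p g h z : D m -> filt m g -> filt n h -> filt p z ->
  eqmod (ltm (addm (addm m n) p)) [~ g, [~ h, z]] ([~ [~ g, h], z] * [~ [~ g, z], h]^-1).
Proof.
move=> Dm hg hh hz; set u := [~ h, z]; set k := addm (addm m n) p.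
set a := [~ g, h]; set b := [~ g, z]; set c := [~ a, z]; set d := [~ b, h].
have hu : filt (addm n p) u by apply: filt_comm.
have ha : filt (addm m n) a by apply: filt_comm.
have hb : filt (addm m p) b by apply: filt_comm.
have hc : filt k c by apply: filt_comm.
have hd : filt k d by rewrite /k -addmA (addmC n) addmA; apply: filt_comm.
pose r := [~ [~ g, z * h], u].
have hr : nset (ltm k) r.
  have hgzh : nset (ltm m) [~ g, z * h].
    by rewrite commgM; apply: nset_mul; [|apply: nset_conj (filt_nset hh)]; apply: comm_ltm hg _; eassumption.
  by rewrite /r /k -addmA; apply: nset_comm hgzh (filt_nset hu) => m1 n1; apply: lt_add.
have e : [~ g, u] = (b * a * (a * b)^-1) * (c * r^-1 * d^-1) ^ (a * b)^-1.
  have : [~ g, h * z] = [~ g, z * h * u] by rewrite /u -commgC.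
  rewrite commgM_err -/a -/b -/c commgM conjg_comm -/r [in RHS]commgM_err -/a -/b -/d.
  move=> E; apply: (mulIg (a * b * d * r)); rewrite -E.
  by move: (c) (d) (r) (a) (b) => c' d' r' a' b'; group_norm.
(* This is a commutator of degree [2m + n + p], strictly above [k] because [m] is positive at
   [d0]. *)
have hab : nset (ltm k) (b * a * (a * b)^-1).
  have -> : b * a * (a * b)^-1 = [~ b^-1, a^-1] by group_norm.
  apply: nset_comm (filt_nset (filt_inv hb)) (filt_nset (filt_inv ha)) => m1 n1 h1 h2.
  apply: lt_le_trans (lem_add h1 h2).
  split; first by move=> j; rewrite /k /addm; lia.
  by exists d0; rewrite /k /addm; move: Dm; rewrite /D; lia.
set Y := c * r^-1 * d^-1 in e.
have hd' := nset_inv (filt_nset hd).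
have hY : nset (lem k) Y.
  apply: nset_mul hd'; apply: nset_mul (filt_nset hc) (nset_inv _).
  by apply: nset_sub hr => m1; apply: ltm_le.
have hv : nset (@nzm J) (a * b)^-1.
  by apply/nset_inv/nset_mul; [apply: (nset_base (filt_nz ha) ha) | apply: (nset_base (filt_nz hb) hb)].
have hYv : nset (ltm k) [~ Y, (a * b)^-1].
  by apply: nset_comm hY hv => m1 n1 h1 h2; apply: le_lt_trans h1 (ltm_addr _ h2).
rewrite e; apply: eqmod_trans (eqmod_mul (nset_conj hY hv) (h := Y ^ (a * b)^-1) (h' := Y) (g' := 1) _ _) _.
- by apply/eqmod1.
- by apply: eqmod_sym; apply: eqmodMr hYv _; rewrite conjg_comm.
rewrite mul1g; apply: eqmod_mul hd' _ (eqmod_refl _ _ _).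
by apply: eqmod_sym; apply: eqmodMr (nset_inv hr) erefl.
Qed.

(* [graded] is the product over [m] of the quotients of [filt m] by
   [torsion m]; off the ideal degrees the value of a family is irrelevant. *)
Definition family := {f : (J -> nat) -> G | forall m, D m -> filt m (f m)}.
Lemma family_filt (f : family) m : D m -> filt m (sval f m).
Proof. by case: f => f hf /=; apply: hf. Qed.

HB.instance Definition _ := gen_eqMixin family.
HB.instance Definition _ := gen_choiceMixin family.

Definition family_equiv (f f' : family) : bool :=
  `[< forall m, D m -> torsion m ((sval f m)^-1 * sval f' m) >].

Lemma family_equiv_refl : reflexive family_equiv.
Proof. by move=> f; apply/asboolP => m _; rewrite mulVg; apply/torsion_ltm; left. Qed.

Lemma family_equiv_sym : symmetric family_equiv.
Proof.
move=> f f'; apply/asboolP/asboolP => h m /h /torsion_inv; by rewrite invgM invgK.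
Qed.

Lemma family_equiv_trans : transitive family_equiv.
Proof.
move=> f1 f2 f3 /asboolP h12 /asboolP h23; apply/asboolP => m Dm.
have := torsion_mul _ _ (h12 m Dm) (h23 m Dm).
rewrite -mulgA mulVKg; apply; apply: filt_mul (filt_inv _) _; exact: family_filt.
Qed.

Canonical family_equiv_rel :=
  EquivRel family_equiv family_equiv_refl family_equiv_sym family_equiv_trans.

Definition graded := {eq_quot family_equiv_rel}%qT.
HB.instance Definition _ := Choice.on graded.
HB.instance Definition _ := EqQuotient.on graded.

Definition gpi (f : family) : graded := (\pi_graded f)%qT.

Lemma gpi_eq f f' :
  gpi f = gpi f' <-> forall m, D m -> torsion m ((sval f m)^-1 * sval f' m).
Proof.
split=> [/eqquotP/asboolP //|h]; apply/eqquotP/asboolP; exact: h.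
Qed.

Lemma gpi_surj (u : graded) : exists f, u = gpi f.
Proof. by exists (repr u); rewrite /gpi reprK. Qed.


Lemma fam_mul_subproof (f f' : family) m : D m -> filt m (sval f m * sval f' m).
Proof. by move=> Dm; apply: filt_mul; apply: family_filt. Qed.
Definition fam_mul (f f' : family) : family :=
  exist _ (fun m => sval f m * sval f' m) (fam_mul_subproof f f').

Lemma fam_inv_subproof (f : family) m : D m -> filt m (sval f m)^-1.
Proof. by move=> Dm; apply: filt_inv; apply: family_filt. Qed.
Definition fam_inv (f : family) : family :=
  exist _ (fun m => (sval f m)^-1) (fam_inv_subproof f).

Lemma fam_one_subproof m : D m -> filt m 1.
Proof. by move=> Dm; apply/filt_one/ideal_degree_nzm. Qed.
Definition fam_one : family := exist _ (fun=> 1) fam_one_subproof.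

Lemma repr_gpi f m : D m -> torsion m ((sval (repr (gpi f)) m)^-1 * sval f m).
Proof. by move: m; apply/gpi_eq; rewrite /gpi reprK. Qed.

Definition gadd (u v : graded) := gpi (fam_mul (repr u) (repr v)).
Definition gopp (u : graded) := gpi (fam_inv (repr u)).

Lemma gaddE f f' : gadd (gpi f) (gpi f') = gpi (fam_mul f f').
Proof.
apply/gpi_eq => m Dm /=; set a := sval (repr _) m; set b := sval (repr _) m.
have -> : (a * b)^-1 * (sval f m * sval f' m) =
    (a^-1 * sval f m) ^ b * (b^-1 * sval f' m) by group_norm.
have hb : filt m b by apply: family_filt.
have ha : filt m a by apply: family_filt.
apply: torsion_mul; last exact: repr_gpi.
- by apply: filt_conj hb; apply: filt_mul (filt_inv ha) _; apply: family_filt.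
- by apply: filt_mul (filt_inv hb) _; apply: family_filt.
- by apply: torsion_conj hb _; apply: repr_gpi.
Qed.

Lemma goppE f : gopp (gpi f) = gpi (fam_inv f).
Proof.
apply/gpi_eq => m Dm /=; set a := sval (repr _) m.
have -> : a^-1^-1 * (sval f m)^-1 = ((a^-1 * sval f m)^-1) ^ a^-1 by group_norm.
apply: (@torsion_conj m m); last by apply/torsion_inv/repr_gpi.
by apply: filt_inv; apply: family_filt.
Qed.

Lemma gaddA : associative gadd.
Proof.
move=> u v w; have [f ->] := gpi_surj u; have [g ->] := gpi_surj v; have [h ->] := gpi_surj w.
by rewrite !gaddE; apply/gpi_eq => m Dm /=; rewrite -[_ * _ * sval h m]mulgA mulVg; apply/torsion_ltm; left.
Qed.

Lemma gaddC : commutative gadd.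
Proof.
move=> u v; have [f ->] := gpi_surj u; have [g ->] := gpi_surj v.
rewrite !gaddE; apply/gpi_eq => m Dm /=; apply/torsion_ltm.
apply: eqmodM_comm; apply: comm_ltm; exact: family_filt.
Qed.

Lemma gadd0 : left_id (gpi fam_one) gadd.
Proof.
move=> u; have [f ->] := gpi_surj u.
by rewrite !gaddE; apply/gpi_eq => m Dm /=; rewrite mul1g mulVg; apply/torsion_ltm; left.
Qed.

Lemma gaddN : left_inverse (gpi fam_one) gopp gadd.
Proof.
move=> u; have [f ->] := gpi_surj u.
by rewrite goppE gaddE; apply/gpi_eq => m Dm /=; rewrite !mulVg; apply/torsion_ltm; left.
Qed.

HB.instance Definition _ := GRing.isZmodule.Build graded gaddA gaddC gadd0 gaddN.

Lemma gpiD f f' : (gpi f + gpi f' = gpi (fam_mul f f'))%R.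
Proof. exact: gaddE. Qed.
Lemma gpi0 : gpi fam_one = 0%R. Proof. by []. Qed.

Lemma gpi_eq0 f : gpi f = 0%R <-> forall m, D m -> torsion m (sval f m).
Proof.
rewrite -gpi0; split=> [/gpi_eq h m /h /torsion_inv|h].
  by rewrite /= mulg1 invgK.
by apply/gpi_eq => m /h /torsion_inv; rewrite /= mulg1.
Qed.

Lemma graded_torsion_free k (u : graded) : k \in [:: 2; 3; 5] -> (u *+ k = 0)%R -> u = 0%R.
Proof.
move=> hk; have [f ->] := gpi_surj u.
have -> : (gpi f *+ k)%R = gpi (iter k (fam_mul f) fam_one).
  by elim: k {hk} => // k IH; rewrite mulrS IH gpiD.
move=> /gpi_eq0 h; apply/gpi_eq0 => m /h [l hl]; exists l.+1.
have {hl} : nset (ltm m) ((sval f m ^+ k) ^+ (30 ^ l)).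
  suff <- : sval (iter k (fam_mul f) fam_one) m = sval f m ^+ k by [].
  by elim: k {hk h hl} => //= k ->; rewrite expgS.
rewrite -expgnA expnS => hl.
have -> : (30 * 30 ^ l = k * 30 ^ l * (30 %/ k))%N.
  by rewrite mulnAC; congr (_ * _)%N; move: hk; rewrite !inE => /or3P[]/eqP->.
by rewrite expgnA; apply: nset_exp.
Qed.

Record letter := Letter {ldeg : J -> nat; lelt : G; lfilt : filt ldeg lelt}.
Implicit Type z : letter.

Definition subm m n : J -> nat := fun j => (m j - n j)%N.
Lemma submK m n : lem n m -> addm (subm m n) n = m.
Proof. by move=> h; apply/funext => j; rewrite /addm /subm subnK. Qed.
Lemma addmK m n : subm (addm m n) n = m.
Proof. by apply/funext => j; rewrite /addm /subm addnK. Qed.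

(** Commutation with [z] shifts degrees by [ldeg z], so the component at [m] is read at the
    difference; it is 1 when that difference is not a degree of the ideal. *)
Definition fam_act_fun z (f : family) m : G :=
  if `[< lem (ldeg z) m >] && D (subm m (ldeg z)) then [~ sval f (subm m (ldeg z)), lelt z] else 1.
Lemma fam_act_subproof z f m : D m -> filt m (fam_act_fun z f m).
Proof.
rewrite /fam_act_fun => Dm; case: ifP => [/andP[/asboolP le Dm']|_]; last exact/filt_one/ideal_degree_nzm.
by rewrite -{1}(submK le); apply: filt_comm (lfilt z); apply: family_filt.
Qed.
Definition fam_act z f : family := exist _ (fam_act_fun z f) (fam_act_subproof z f).
Definition gact z (u : graded) : graded := gpi (fam_act z (repr u)).

Lemma gactE z f : gact z (gpi f) = gpi (fam_act z f).
Proof.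
apply/gpi_eq => m Dm /=; rewrite /fam_act_fun.
case: ifP => [/andP[/asboolP le Dm']|_]; last by rewrite mulVg; apply/torsion_ltm; left.
set n := subm _ _ in Dm' *; set a := sval (repr _) n; set b := sval f n.
have ha : filt n a by apply: family_filt.
have hb : filt n b by apply: family_filt.
have hab : torsion n (a^-1 * b) by apply: repr_gpi.
have hab' : filt n (a^-1 * b) by apply: filt_mul (filt_inv ha) hb.
have hz := lfilt z; rewrite -(submK le) -/n.
have := torsion_comm Dm' hab' hz hab.
have e : eqmod (ltm (addm n (ldeg z))) [~ b, lelt z] ([~ a, lelt z] * [~ a^-1 * b, lelt z]).
  by rewrite -{1}(mulVKg a b); apply: commMg_mod.
have hc : nset (lem (addm n (ldeg z))) [~ b, lelt z] by apply/filt_nset/filt_comm.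
have ha' : filt (addm n (ldeg z)) [~ a, lelt z] by apply: filt_comm.
have hd' : filt (addm n (ldeg z)) [~ a^-1 * b, lelt z] by apply: filt_comm.
move=> ht.
have e' : eqmod (ltm (addm n (ldeg z))) [~ a^-1 * b, lelt z] ([~ a, lelt z]^-1 * [~ b, lelt z]).
  have := eqmod_mul hc (eqmod_refl gens (ltm (addm n (ldeg z))) [~ a, lelt z]^-1) e.
  by rewrite mulKg => /eqmod_sym.
apply: (torsion_eqmod _ _ e' ht) => //.
by apply: filt_mul; [apply: filt_inv | apply: filt_comm].
Qed.

Lemma gactD z : {morph gact z : u v / (u + v)%R}.
Proof.
move=> u v; have [f ->] := gpi_surj u; have [g ->] := gpi_surj v.
rewrite gpiD !gactE gpiD; apply/gpi_eq => m Dm /=; rewrite /fam_act_fun.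
case: ifP => [/andP[/asboolP le Dm']|_]; last by rewrite mul1g mulVg; apply/torsion_ltm; left.
rewrite -{1}(submK le); apply: torsion_ltm; apply: commMg_mod => //; last exact: lfilt.
all: exact: family_filt.
Qed.

(** Testing [filt m g] inside makes [cls m g] total in [g], so that classes can be written without
    carrying a proof. *)
Definition single_fun m g n : G := if `[< n = m /\ filt m g >] then g else 1.
Lemma single_subproof m g n : D n -> filt n (single_fun m g n).
Proof.
by rewrite /single_fun => Dn; case: asboolP => [[->]|_] //; apply/filt_one/ideal_degree_nzm.
Qed.
Definition single m g : family := exist _ (single_fun m g) (single_subproof m g).
Definition cls m g : graded := gpi (single m g).

Lemma singleE m g : filt m g -> single_fun m g m = g.
Proof. by move=> h; rewrite /single_fun; case: asboolP => // -[]. Qed.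
Lemma singleN m g n : n <> m -> single_fun m g n = 1.
Proof. by move=> h; rewrite /single_fun; case: asboolP => // -[]. Qed.

Lemma cls_eq m g h : D m -> filt m g -> filt m h ->
  (cls m g = cls m h <-> torsion m (g^-1 * h)).
Proof.
move=> Dm hg hh; split=> [/gpi_eq/(_ m Dm)|ht]; first by rewrite /= !singleE.
apply/gpi_eq => n Dn /=; have [->|nm] := pselect (n = m); first by rewrite !singleE.
by rewrite !singleN // mulVg; apply/torsion_ltm; left.
Qed.

Lemma cls_mul m g h : D m -> filt m g -> filt m h -> cls m (g * h) = (cls m g + cls m h)%R.
Proof.
move=> Dm hg hh; rewrite gpiD; congr gpi; apply: eq_exist; apply/funext => n.
have [->|nm] := pselect (n = m); last by rewrite /= !singleN // mulg1.
by rewrite /= !singleE //; apply: filt_mul.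
Qed.

Lemma cls1 m : cls m 1 = 0%R.
Proof. by apply/gpi_eq0 => n Dn; rewrite /= /single_fun if_same; apply/torsion_ltm; left. Qed.

Lemma cls_inv m g : D m -> filt m g -> cls m g^-1 = (- cls m g)%R.
Proof.
move=> Dm hg; apply/eqP; rewrite -subr_eq0 opprK -cls_mul ?mulVg ?cls1 //.
exact: filt_inv.
Qed.

Lemma cls_mod m g h : D m -> filt m g -> eqmod (ltm m) g h -> filt m h -> cls m g = cls m h.
Proof. by move=> Dm hg e hh; apply/cls_eq => //; apply: torsion_ltm. Qed.

Lemma cls_eq0 m g : D m -> filt m g -> (cls m g = 0%R <-> torsion m g).
Proof.
move=> Dm hg; rewrite -(cls1 m) cls_eq //; last exact/filt_one/ideal_degree_nzm.
by split=> /torsion_inv; rewrite mulg1 ?invgK.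
Qed.

Lemma gact_cls z m g : D m -> filt m g ->
  gact z (cls m g) = cls (addm m (ldeg z)) [~ g, lelt z].
Proof.
move=> Dm hg; rewrite gactE; congr gpi; apply: eq_exist; apply/funext => n.
rewrite /fam_act_fun /=.
have [->|nm] := pselect (n = addm m (ldeg z)).
  rewrite addmK Dm andbT !singleE //; last by apply: filt_comm (lfilt z).
  by case: asboolP => // -[]; apply: lem_addl.
rewrite [RHS]singleN //; case: ifP => // /andP[/asboolP le _].
by rewrite singleN ?comm1g // => e; case: nm; rewrite -e submK.
Qed.

End Graded.

(** * Lie words *)

Local Open Scope ring_scope.

(* Integral noncommutative polynomials in tokens: 0 is the operator [x], 1 the
   letter a word is rewritten to start with, [2, 3, ...] the other letters. *)
Definition ncpoly := seq (int * seq nat).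
Definition pmul (p q : ncpoly) : ncpoly := [seq (a.1 * b.1, a.2 ++ b.2) | a <- p, b <- q].
Definition popp (p : ncpoly) : ncpoly := [seq (- a.1, a.2) | a <- p].
Definition pscale (c : int) (p : ncpoly) : ncpoly := [seq (c * a.1, a.2) | a <- p].
Definition pword (m : seq nat) : ncpoly := [:: (1, m)].
(* The left-normed commutator of the tokens of [s], acting from the right. *)
Definition liep (s : seq nat) : ncpoly :=
  if s is t :: r then
    foldl (fun p z => pmul p (pword [:: z]) ++ popp (pmul (pword [:: z]) p)) (pword [:: t]) r
  else [::].
(** Entries of [perms4] count from 1, hence the predecessor. The default [[:: 0]] is the operator
    [x], itself a legal Lie word, so even a short list [gs] gives a true instance. *)
Definition symp (u : seq nat) (gs : seq (seq nat)) (v : seq nat) : ncpoly :=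
  flatten [seq pmul (pmul (pword u)
    (foldl pmul (pword [::]) [seq liep (nth [:: 0%N] gs i.-1) | i <- t])) (pword v) | t <- perms4].

(** Insertion stops at the first [x]: only letters within one gap may be permuted, and only modulo
    words with fewer letters. *)
Fixpoint insert_letter (a : nat) (w : seq nat) : seq nat :=
  if w is b :: w' then
    if (b == 0%N) || (a <= b)%N then a :: w else b :: insert_letter a w'
  else [:: a].
Definition sort_letters (w : seq nat) : seq nat :=
  foldr (fun a w => if a == 0%N then a :: w else insert_letter a w) [::] w.

Definition reduce (ok kill : pred (seq nat)) (p : ncpoly) : ncpoly :=
  flatten [seq if ok a.2 then let m := sort_letters a.2 in
     if kill m then [::] else [:: (a.1, m)] else [:: a] | a <- p].

Fixpoint add_term (c : int) (m : seq nat) (p : ncpoly) : ncpoly :=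
  if p is a :: p' then
    if a.2 == m then (a.1 + c, m) :: p' else a :: add_term c m p'
  else [:: (c, m)].
Definition collect (p : ncpoly) : ncpoly := foldr (fun a => add_term a.1 a.2) [::] p.
Definition is_zero (p : ncpoly) := all (fun a => a.1 == 0) (collect p).

Section PolyValue.
Variables (V : zmodType) (val : seq nat -> V).

Definition pvalue (p : ncpoly) : V := \sum_(a <- p) val a.2 *~ a.1.

Lemma pvalue_cat p q : pvalue (p ++ q) = pvalue p + pvalue q.
Proof. exact: big_cat. Qed.

Lemma pvalue_opp p : pvalue (popp p) = - pvalue p.
Proof. by rewrite /pvalue big_map -sumrN; apply: eq_bigr => a _; rewrite mulrNz. Qed.

Lemma pvalue_scale c p : pvalue (pscale c p) = pvalue p *~ c.
Proof.
rewrite /pvalue big_map mulrz_suml; apply: eq_bigr => a _ /=.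
by rewrite mulrC mulrzA.
Qed.

Lemma pvalue_flatten ps : pvalue (flatten ps) = \sum_(p <- ps) pvalue p.
Proof.
elim: ps => [|p ps IH] /=; first by rewrite /pvalue !big_nil.
by rewrite pvalue_cat big_cons IH.
Qed.

Lemma pvalue_zero p : is_zero p -> pvalue p = 0.
Proof.
have add c m q : pvalue (add_term c m q) = val m *~ c + pvalue q.
  elim: q => [|a q IH] /=; first by rewrite /pvalue big_cons.
  case: eqP => [<-|_]; first by rewrite /pvalue !big_cons /= mulrzDr addrCA addrA.
  by rewrite /pvalue !big_cons -!/(pvalue _) IH addrCA.
have -> : pvalue p = pvalue (collect p).
  by elim: p => //= a p IH; rewrite add -IH /pvalue big_cons.
move=> /allP h; rewrite /pvalue big_seq big1 // => a /h /eqP->.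
by rewrite mulr0z.
Qed.

Lemma pvalue_reduce (ok kill : pred (seq nat)) p :
  (forall m, ok m -> val (sort_letters m) = val m) ->
  (forall m, ok m -> kill (sort_letters m) -> val m = 0) ->
  pvalue (reduce ok kill p) = pvalue p.
Proof.
move=> hs hk; rewrite /reduce pvalue_flatten big_map /pvalue; apply: eq_bigr => a _.
case: ifP => [oka|_]; last by rewrite big_seq1.
case: ifP => [/(hk _ oka) ->|_]; first by rewrite big_nil mul0rz.
by rewrite big_seq1 hs.
Qed.

End PolyValue.

(** * Certificates and their checker *)

Definition smooth (ps : seq nat) := all [in [:: 2; 3; 5]%N] ps.

(* [Sym s m gs m'] is the linearised Engel identity in the context [s m _ m'] at
   the four Lie words [gs]; [Pre s m] says that [s m 1] vanishes because its prefix
   [s m] has one letter less. *)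
Inductive relation :=
| Sym of nat & seq nat & seq (seq nat) & seq nat
| Pre of nat & seq nat.

Definition lie_word (s : seq nat) := (s == [:: 0%N]) || (head 0%N s != 0%N).

(* Antisymmetry: [s w1 1 w2 = - 1 (ad [s w1]) w2] for the letters [s] and 1. *)
Definition exchange (s : nat) (m : seq nat) : ncpoly :=
  popp (pmul (liep (s :: take (index 1%N m) m)) (pword (drop (index 1%N m).+1 m))).

(** Ill-formed relations yield the zero polynomial, so soundness asks nothing of the certificate
    data. Killing monomials before the exchange is legitimate because the killed shapes vanish for
    every initial letter, in particular for [s]. *)
Definition relation_poly (ok pok kill : pred (seq nat)) (R : relation) : ncpoly :=
  match R with
  | Sym s m gs m' =>
    let p := symp m gs m' in
    if ~~ all lie_word gs then [::] else
    if s == 1%N then p else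
    let p' := reduce ok kill p in
    if (s != 0%N) && all (fun a => 1%N \in a.2) p' then
      flatten [seq pscale a.1 (exchange s a.2) | a <- p']
    else [::]
  | Pre s m =>
    if (s != 0%N) && pok m && (1%N \notin m) then exchange s (rcons m 1%N) else [::]
  end.

Definition count_ok (k l : nat) : pred (seq nat) := fun m =>
  (count (predC1 0%N) m == k) && (count (pred1 0%N) m == l).

Definition prefix_ok (n : nat) : pred (seq nat) := fun m => (0 < n)%N && count_ok n.-1 4 m.

Definition gaps (m : seq nat) : seq nat * seq nat * seq nat :=
  let cut s := (take (index 0%N s) s, drop (index 0%N s).+1 s) in
  let: (A, m1) := cut (behead m) in
  let: (B, m2) := cut m1 in
  let: (C, _) := cut m2 in (A, B, C).
Definition of_gaps (A B C : seq nat) : seq nat :=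
  0%N :: A ++ 0%N :: B ++ 0%N :: C ++ [:: 0%N].
Definition kill_start (m : seq nat) := head 0%N m != 0%N.
Definition kill_end (m : seq nat) := last 0%N m != 0%N.
Definition kill_shape (zs : seq (nat * nat * nat)) (m : seq nat) :=
  let: (A, B, C) := gaps m in
  [&& m == of_gaps A B C, 0%N \notin A ++ B ++ C &
      [|| (2 < size A)%N, (3 < size B)%N, (2 < size C)%N | (size A, size B, size C) \in zs]].
Definition kill_word zs m := [|| kill_start m, kill_end m | kill_shape zs m].

(** The general word of its shape: distinct letters, numbered from 2 since 0 is [x] and 1 is the
    initial letter. *)
Definition gap_target (a b c : nat) : seq nat :=
  of_gaps (iota 2 a) (iota (2 + a) b) (iota (2 + a + b) c).

Definition check_certificate (zs : seq (nat * nat * nat)) (abc : nat * nat * nat)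
    (cert : seq (int * relation)) (ps : seq nat) : bool :=
  let: (a, b, c) := abc in
  let n := (a + b + c)%N in
  let ok := count_ok n 4 in
  let kill := kill_word zs in
  smooth ps && is_zero (reduce ok kill
    (flatten [seq pscale x.1 (relation_poly ok (prefix_ok n) kill x.2) | x <- cert] ++
       [:: (- (foldr muln 1%N ps)%:Z, gap_target a b c)])).

(* For words with [n] letters after the first, [(a, b, c)] are the lengths of
   [A, B, C] in the shape [y x A x B x C x]; the listed combination equals the product
   of the listed primes times that word, modulo the shapes already treated.
   The combinations were found by elimination over [Z[1/30]]. *)
Definition certificates (n : nat) : seq (nat * nat * nat * seq (int * relation) * seq nat) :=
  match n with
  | 0 => [::
      ((0, 0, 0)%N,
       [:: (1%Z, (Sym 1 [::] [:: [:: 0]; [:: 0]; [:: 0]; [:: 0]] [::])%N)],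
       [:: 2; 2; 2; 3]%N)]
  | 1 => [::
      ((0, 1, 0)%N,
       [:: (2%Z, (Sym 1 [::] [:: [:: 0]; [:: 0]; [:: 0]; [:: 2]] [:: 0])%N);
        ((-3)%Z, (Pre 2 [:: 0; 0; 0; 0])%N)],
       [:: 2; 3; 5]%N);
      ((0, 0, 1)%N,
       [:: (4%Z, (Sym 1 [::] [:: [:: 0]; [:: 0]; [:: 0]; [:: 2]] [:: 0])%N);
        ((-1)%Z, (Sym 2 [::] [:: [:: 0]; [:: 0]; [:: 0]; [:: 1]] [:: 0])%N)],
       [:: 2; 3; 3]%N);
      ((1, 0, 0)%N,
       [:: (1%Z, (Sym 1 [::] [:: [:: 0]; [:: 0]; [:: 0]; [:: 2]] [:: 0])%N)],
       [:: 2; 3]%N)]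
  | 2 => [::
      ((0, 0, 2)%N,
       [:: ((-1)%Z, (Sym 3 [::] [:: [:: 0]; [:: 0]; [:: 0]; [:: 1]] [:: 2; 0])%N);
        (6%Z, (Sym 1 [::] [:: [:: 0]; [:: 0]; [:: 0]; [:: 3]] [:: 2; 0])%N);
        (24%Z, (Sym 2 [::] [:: [:: 0]; [:: 0]; [:: 1]; [:: 3]] [:: 0; 0])%N);
        (3%Z, (Sym 2 [::] [:: [:: 0]; [:: 0]; [:: 0]; [:: 1]] [:: 3; 0])%N);
        ((-40)%Z, (Sym 1 [:: 0; 2] [:: [:: 0]; [:: 0]; [:: 0]; [:: 3]] [::])%N);
        (10%Z, (Sym 1 [:: 0; 3] [:: [:: 0]; [:: 0]; [:: 0]; [:: 2]] [::])%N);
        (32%Z, (Sym 1 [::] [:: [:: 0]; [:: 0]; [:: 0]; [:: 2]] [:: 3; 0])%N);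
        (6%Z, (Sym 1 [::] [:: [:: 0]; [:: 0]; [:: 2]; [:: 3]] [:: 0; 0])%N);
        (30%Z, (Sym 1 [::] [:: [:: 0]; [:: 0]; [:: 2]; [:: 3; 0; 0]] [::])%N)],
       [:: 2; 2; 3; 5; 5]%N);
      ((0, 1, 1)%N,
       [:: (3%Z, (Sym 1 [::] [:: [:: 0]; [:: 0]; [:: 0]; [:: 2]] [:: 3; 0])%N);
        ((-1)%Z, (Sym 2 [::] [:: [:: 0]; [:: 0]; [:: 0]; [:: 1]] [:: 3; 0])%N)],
       [:: 2; 2; 2; 3]%N);
      ((0, 2, 0)%N,
       [:: (1%Z, (Sym 1 [:: 0; 0] [:: [:: 0]; [:: 0]; [:: 2]; [:: 3]] [::])%N)],
       [:: 2; 2]%N);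
      ((1, 0, 1)%N,
       [:: (1%Z, (Sym 1 [::] [:: [:: 0]; [:: 0]; [:: 0]; [:: 2]] [:: 3; 0])%N)],
       [:: 2; 3]%N);
      ((2, 0, 0)%N,
       [:: (1%Z, (Sym 1 [:: 0; 3] [:: [:: 0]; [:: 0]; [:: 0]; [:: 2]] [::])%N);
        ((-2)%Z, (Pre 2 [:: 0; 0; 0; 3; 0])%N)],
       [:: 2; 2; 2]%N);
      ((1, 1, 0)%N,
       [:: (1%Z, (Sym 1 [:: 0; 2] [:: [:: 0]; [:: 0]; [:: 0]; [:: 3]] [::])%N)],
       [:: 2; 3]%N)]
  | 3 => [::
      ((0, 1, 2)%N,
       [:: (3%Z, (Sym 1 [::] [:: [:: 0]; [:: 0]; [:: 0]; [:: 2]] [:: 3; 4; 0])%N);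
        ((-1)%Z, (Sym 2 [::] [:: [:: 0]; [:: 0]; [:: 0]; [:: 1]] [:: 3; 4; 0])%N)],
       [:: 2; 2; 2; 3]%N);
      ((1, 0, 2)%N,
       [:: (1%Z, (Sym 1 [::] [:: [:: 0]; [:: 0]; [:: 0]; [:: 2]] [:: 3; 4; 0])%N)],
       [:: 2; 3]%N);
      ((2, 0, 1)%N,
       [:: (1%Z, (Sym 1 [:: 0; 2; 3] [:: [:: 0]; [:: 0]; [:: 0]; [:: 4]] [::])%N);
        (2%Z, (Pre 4 [:: 0; 0; 0; 2; 3; 0])%N)],
       [:: 2; 2; 3]%N);
      ((2, 1, 0)%N,
       [:: (1%Z, (Sym 1 [:: 0; 2; 3] [:: [:: 0]; [:: 0]; [:: 0]; [:: 4]] [::])%N)],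
       [:: 2; 3]%N);
      ((0, 3, 0)%N,
       [:: ((-5)%Z, (Sym 1 [::] [:: [:: 0]; [:: 0]; [:: 3]; [:: 4]] [:: 2; 0; 0])%N);
        (5%Z, (Sym 1 [::] [:: [:: 0]; [:: 0]; [:: 2]; [:: 4]] [:: 3; 0; 0])%N);
        (7%Z, (Sym 1 [::] [:: [:: 0]; [:: 0]; [:: 2]; [:: 3]] [:: 4; 0; 0])%N);
        ((-2)%Z, (Sym 2 [::] [:: [:: 0]; [:: 0]; [:: 1]; [:: 3]] [:: 4; 0; 0])%N)],
       [:: 2; 2; 2; 5]%N);
      ((0, 2, 1)%N,
       [:: (1%Z, (Sym 1 [:: 0; 0; 3] [:: [:: 0]; [:: 0]; [:: 2]; [:: 4]] [::])%N);
        (1%Z, (Sym 1 [:: 0; 0; 2] [:: [:: 0]; [:: 0]; [:: 3]; [:: 4]] [::])%N);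
        ((-1)%Z, (Sym 1 [:: 0; 0; 4] [:: [:: 0]; [:: 0]; [:: 2]; [:: 3]] [::])%N)],
       [:: 2; 2]%N);
      ((1, 1, 1)%N,
       [:: ((-1)%Z, (Sym 1 [::] [:: [:: 0]; [:: 0]; [:: 2]; [:: 3]] [:: 0; 4; 0])%N);
        (1%Z, (Sym 2 [::] [:: [:: 0]; [:: 0]; [:: 1]; [:: 3]] [:: 0; 4; 0])%N)],
       [:: 2]%N);
      ((1, 2, 0)%N,
       [:: (1%Z, (Sym 1 [:: 0; 2] [:: [:: 0]; [:: 0]; [:: 3]; [:: 4]] [:: 0])%N)],
       [:: 2; 2]%N)]
  | 4 => [::
      ((1, 3, 0)%N,
       [:: (1%Z, (Sym 2 [::] [:: [:: 0]; [:: 0]; [:: 1]; [:: 3]] [:: 4; 5; 0; 0])%N);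
        ((-1)%Z, (Sym 1 [::] [:: [:: 0]; [:: 0]; [:: 2]; [:: 3]] [:: 4; 5; 0; 0])%N)],
       [:: 2]%N);
      ((2, 2, 0)%N,
       [:: (1%Z, (Sym 1 [::] [:: [:: 0]; [:: 0]; [:: 2]; [:: 3]] [:: 4; 5; 0; 0])%N)],
       [:: 2; 2]%N);
      ((1, 2, 1)%N,
       [:: (1%Z, (Sym 1 [::] [:: [:: 0]; [:: 0]; [:: 2]; [:: 3]] [:: 4; 0; 5; 0])%N);
        (2%Z, (Sym 2 [:: 0] [:: [:: 0]; [:: 1]; [:: 3]; [:: 4]] [:: 0; 5; 0])%N);
        ((-1)%Z, (Sym 3 [::] [:: [:: 0]; [:: 0]; [:: 1]; [:: 2]] [:: 4; 0; 5; 0])%N);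
        ((-1)%Z, (Sym 4 [::] [:: [:: 0]; [:: 0]; [:: 1]; [:: 2]] [:: 3; 0; 5; 0])%N);
        (1%Z, (Sym 1 [::] [:: [:: 0]; [:: 0]; [:: 2]; [:: 4]] [:: 3; 0; 5; 0])%N);
        (1%Z, (Sym 1 [::] [:: [:: 0]; [:: 0]; [:: 3]; [:: 4]] [:: 2; 0; 5; 0])%N)],
       [:: 2; 2; 2; 5]%N);
      ((1, 1, 2)%N,
       [:: (1%Z, (Sym 1 [:: 0; 2; 0; 3] [:: [:: 0]; [:: 0]; [:: 4]; [:: 5]] [::])%N)],
       [:: 2; 2]%N);
      ((0, 2, 2)%N,
       [:: (1%Z, (Sym 1 [::] [:: [:: 0]; [:: 0]; [:: 2]; [:: 3]] [:: 0; 4; 5; 0])%N);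
        ((-1)%Z, (Sym 2 [::] [:: [:: 0]; [:: 0]; [:: 1]; [:: 3]] [:: 0; 4; 5; 0])%N)],
       [:: 2; 2; 2]%N);
      ((0, 3, 1)%N,
       [:: (1%Z, (Sym 1 [:: 0; 0] [:: [:: 0]; [:: 2]; [:: 3]; [:: 4]] [:: 5; 0])%N)],
       [:: 2; 3]%N);
      ((2, 0, 2)%N,
       [:: (1%Z, (Sym 1 [::] [:: [:: 0]; [:: 0]; [:: 2]; [:: 3]] [:: 0; 4; 5; 0])%N)],
       [:: 2; 2]%N);
      ((2, 1, 1)%N,
       [:: (1%Z, (Sym 1 [::] [:: [:: 0]; [:: 0]; [:: 2]; [:: 3]] [:: 4; 0; 5; 0])%N)],
       [:: 2; 2]%N)]
  | 5 => [::
      ((0, 3, 2)%N,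
       [:: (1%Z, (Sym 1 [:: 0; 0; 2; 3; 4] [:: [:: 0]; [:: 0]; [:: 5]; [:: 6]] [::])%N)],
       [:: 2; 2]%N);
      ((2, 3, 0)%N,
       [:: (1%Z, (Sym 1 [::] [:: [:: 0]; [:: 0]; [:: 2]; [:: 3]] [:: 4; 5; 6; 0; 0])%N)],
       [:: 2; 2]%N);
      ((1, 2, 2)%N,
       [:: ((-1)%Z, (Sym 1 [::] [:: [:: 0]; [:: 0]; [:: 2]; [:: 3]] [:: 4; 0; 5; 6; 0])%N);
        (1%Z, (Sym 2 [::] [:: [:: 0]; [:: 0]; [:: 1]; [:: 3]] [:: 4; 0; 5; 6; 0])%N)],
       [:: 2]%N);
      ((1, 3, 1)%N,
       [:: (1%Z, (Sym 1 [:: 0; 2; 0] [:: [:: 0]; [:: 3]; [:: 4]; [:: 5]] [:: 6; 0])%N)],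
       [:: 2; 3]%N);
      ((2, 1, 2)%N,
       [:: (1%Z, (Sym 1 [::] [:: [:: 0]; [:: 0]; [:: 2]; [:: 3]] [:: 4; 0; 5; 6; 0])%N)],
       [:: 2; 2]%N);
      ((2, 2, 1)%N,
       [:: (1%Z, (Sym 1 [::] [:: [:: 0]; [:: 0]; [:: 2]; [:: 3]] [:: 4; 5; 0; 6; 0])%N)],
       [:: 2; 2]%N)]
  | 6 => [::
      ((1, 3, 2)%N,
       [:: (1%Z, (Sym 1 [:: 0; 2; 0; 3; 4; 5] [:: [:: 0]; [:: 0]; [:: 6]; [:: 7]] [::])%N)],
       [:: 2; 2]%N);
      ((2, 3, 1)%N,
       [:: (1%Z, (Sym 1 [::] [:: [:: 0]; [:: 0]; [:: 2]; [:: 3]] [:: 4; 5; 6; 0; 7; 0])%N)],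
       [:: 2; 2]%N);
      ((2, 2, 2)%N,
       [:: (1%Z, (Sym 1 [::] [:: [:: 0]; [:: 0]; [:: 2]; [:: 3]] [:: 4; 5; 0; 6; 7; 0])%N)],
       [:: 2; 2]%N)]
  | 7 => [::
      ((2, 3, 2)%N,
       [:: (1%Z, (Sym 1 [::] [:: [:: 0]; [:: 0]; [:: 2]; [:: 3]] [:: 4; 5; 6; 0; 7; 8; 0])%N)],
       [:: 2; 2]%N)]
  | _ => [::]
  end.

Fixpoint check_all (zs : seq (nat * nat * nat))
    (cs : seq (nat * nat * nat * seq (int * relation) * seq nat)) : bool :=
  if cs is (abc, cert, ps) :: cs' then check_certificate zs abc cert ps && check_all (abc :: zs) cs'
  else true.

(** The ranges are the shapes left over by the general bounds on gap lengths, 2 for the outer gaps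
    and 3 for the middle one. *)
Definition small_shapes (n : nat) : seq (nat * nat * nat) :=
  [seq z <- [seq (ab, c) | ab <- [seq (a, b) | a <- iota 0 3, b <- iota 0 4], c <- iota 0 3]
     | z.1.1 + z.1.2 + z.2 == n]%N.

Definition level_check (n : nat) : bool :=
  let cs := certificates n in
  let zs := [seq c.1.1 | c <- cs] in
  [&& all (fun z => z.1.1 + z.1.2 + z.2 == n)%N zs, check_all [::] cs &
      all (mem zs) (small_shapes n)].

Lemma level_check_small n : (n < 8)%N -> level_check n.
Proof. by do 8 (case: n => [_|n]; first by vm_compute). Qed.

(** Small shapes have at most [2 + 3 + 2 = 7] letters, so nothing is left to certify. *)
Lemma level_check_large n : (7 < n)%N -> level_check n.
Proof.
by do 8 (case: n => // n).
Qed.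

(** * Soundness of the checker and vanishing of words with four [x] *)

Section LieWords.
(** [Q] stands for the homogeneous elements of the ideal, [e] for their classes in the Lie ring,
    [T (Some q)] for bracketing with [q], and [T None] for bracketing with [x]. *)
Variables (V : zmodType) (Q : Type) (T : option Q -> V -> V) (e : Q -> V).
Variable qb : Q -> option Q -> Q.
Hypothesis TD : forall z, {morph T z : u v / u + v}.
Hypothesis e_qb : forall q z, e (qb q z) = T z (e q).
Hypothesis T_qb : forall q z r,
  T (Some (qb q z)) (e r) = T z (T (Some q) (e r)) - T (Some q) (T z (e r)).
Hypothesis T_anti : forall q r, T (Some r) (e q) = - T (Some q) (e r).
Hypothesis T_engel : forall q (z : nat -> option Q),
  \sum_(t <- perms4) foldl (fun v i => T (z i) v) (e q) t = 0.
Hypothesis V_torsion : forall p (v : V), p \in [:: 2; 3; 5]%N -> v *+ p = 0 -> v = 0.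

Implicit Types (q : Q) (u w : seq (option Q)) (r : nat -> Q).

Definition act w (v : V) := foldl (fun v z => T z v) v w.

Lemma T0 z : T z 0 = 0.
Proof. by apply: (addIr (T z 0)); rewrite -TD !add0r. Qed.
Lemma actD w : {morph act w : a b / a + b}.
Proof. by elim: w => [|z w IH] a b //; rewrite /act /= TD; apply: IH. Qed.
Lemma act0 w : act w 0 = 0.
Proof. by elim: w => //= z w IH; rewrite T0. Qed.
Lemma actN w v : act w (- v) = - act w v.
Proof. by apply: (addrI (act w v)); rewrite -actD !subrr act0. Qed.
Lemma act_sum w I (s : seq I) F : act w (\sum_(i <- s) F i) = \sum_(i <- s) act w (F i).
Proof. exact: (big_morph _ (actD w) (act0 w)). Qed.
Lemma actMz w (a : V) c : act w (a *~ c) = act w a *~ c.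
Proof.
have Mn k : act w (a *+ k) = act w a *+ k.
  by elim: k => [|k IH]; rewrite ?mulr0n ?act0 // !mulrS actD IH.
by case: c => k; rewrite ?NegzE ?mulrNz ?actN -pmulrn Mn.
Qed.
Lemma act_cat u w v : act (u ++ w) v = act w (act u v).
Proof. exact: foldl_cat. Qed.
(** Any prefix of a word can be absorbed into its initial letter; this is how the number of letters
    is lowered. *)
Lemma act_e w q : act w (e q) = e (foldl qb q w).
Proof. by elim: w q => //= z w IH q; rewrite -e_qb. Qed.

Lemma smooth_torsion ps (v : V) : smooth ps -> v *+ foldr muln 1%N ps = 0 -> v = 0.
Proof.
elim: ps v => [|p ps IH] v /=; first by rewrite mulr1n.
by move=> /andP[hp /IH h]; rewrite mulnC mulrnA => /V_torsion - /(_ hp) /h.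
Qed.


Definition token r (t : nat) : option Q := if t is 0 then None else Some (r t).
Definition bracket_letter r (s : seq nat) : option Q :=
  if s is t :: s' then
    if t is 0 then None else Some (foldl qb (r t) (map (token r) s'))
  else None.

Definition peval r (p : ncpoly) (a : V) := pvalue (fun m => act (map (token r) m) a) p.

Lemma peval_sum r p I (s : seq I) F :
  peval r p (\sum_(i <- s) F i) = \sum_(i <- s) peval r p (F i).
Proof.
rewrite /peval /pvalue exchange_big /=; apply: eq_bigr => a _.
by rewrite act_sum mulrz_suml.
Qed.

Lemma pevalMz r p (a : V) c : peval r p (a *~ c) = peval r p a *~ c.
Proof.
rewrite /peval /pvalue mulrz_suml; apply: eq_bigr => b _.
by rewrite actMz -!mulrzA mulrC.
Qed.

Lemma peval_mul r p p' (a : V) : peval r (pmul p p') a = peval r p' (peval r p a).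
Proof.
have -> : peval r p a = \sum_(b <- p) act (map (token r) b.2) a *~ b.1 by [].
rewrite peval_sum {1}/peval /pvalue big_allpairs_dep; apply: eq_bigr => b _.
rewrite pevalMz /peval /pvalue mulrz_suml; apply: eq_bigr => c _ /=.
by rewrite map_cat act_cat mulrC mulrzA.
Qed.

Lemma peval_word r m (a : V) : peval r (pword m) a = act (map (token r) m) a.
Proof. by rewrite /peval /pvalue big_seq1. Qed.

Lemma peval_liep r s q : lie_word s ->
  peval r (liep s) (e q) = T (bracket_letter r s) (e q).
Proof.
case: s => // -[|t] s; first by rewrite /lie_word /= orbF eqseq_cons => /andP[_ /eqP->]; rewrite peval_word.
move=> _; rewrite /liep /bracket_letter.
elim/last_ind: s q => [|s z IH] q; first by rewrite peval_word.
rewrite foldl_rcons map_rcons foldl_rcons /peval pvalue_cat pvalue_opp -!/(peval _ _ _).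
by rewrite !peval_mul !peval_word IH act_e IH /act /= T_qb e_qb.
Qed.

Lemma peval_symp r (m m' : seq nat) gs q : all lie_word gs ->
  peval r (symp m gs m') (e q) = 0.
Proof.
move=> hgs; have hg i : lie_word (nth [:: 0%N] gs i).
  by have [/(all_nthP [:: 0%N] hgs)|/(nth_default _)->] := ltnP i (size gs).
rewrite /peval pvalue_flatten big_map.
pose q1 := foldl qb q (map (token r) m).
pose F t := foldl (fun a i => T (bracket_letter r (nth [:: 0%N] gs i.-1)) a) (e q1) t.
transitivity (\sum_(t <- perms4) act (map (token r) m') (F t)); last first.
  by rewrite -act_sum T_engel act0.
apply: eq_bigr => t _; rewrite -/(peval _ _ _) !peval_mul !peval_word act_e -/q1.
congr act; rewrite /F; elim/last_ind: t => [|t i IHt]; first by rewrite peval_word.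
rewrite map_rcons !foldl_rcons peval_mul IHt.
have -> : foldl (fun a i => T (bracket_letter r (nth [:: 0%N] gs i.-1)) a) (e q1) t =
    act [seq bracket_letter r (nth [:: 0%N] gs i.-1) | i <- t] (e q1).
  by elim: t (e q1) {IHt} => //= j t IHt a; rewrite IHt.
by rewrite act_e peval_liep.
Qed.

Section Context.
Variables (n : nat) (q0 : Q) (r : nat -> Q) (u0 w0 : seq (option Q)).
(* [k] counts the letters after the initial one. *)
Definition words_vanish (k : nat) := forall q w,
  count isSome w = k -> count (predC isSome) w = 4%N -> act w (e q) = 0.
Hypothesis IH : forall k, (k < n)%N -> words_vanish k.

Definition context_word (m : seq nat) := u0 ++ map (token r) m ++ w0.
Definition context_value m := act (context_word m) (e q0).
Definition context_ok m := (count isSome (context_word m) == n) &&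
  (count (predC isSome) (context_word m) == 4%N).

(** By the Jacobi identity the two words differ by the word in which both letters are replaced by
    their bracket, and this has one letter less. *)
Lemma swap_letters u w p p' q :
  count isSome (u ++ [:: Some p, Some p' & w]) = n ->
  count (predC isSome) (u ++ [:: Some p, Some p' & w]) = 4%N ->
  act (u ++ [:: Some p, Some p' & w]) (e q) = act (u ++ [:: Some p', Some p & w]) (e q).
Proof.
rewrite !count_cat /= !add0n => hn h4; apply/eqP; rewrite -subr_eq0 !act_cat.
rewrite /act /= -!/(act _ _) -actN -actD act_e -T_qb -act_e -[T _ _]/(act [:: _] _) -!act_cat.
apply/eqP/(@IH n.-1); rewrite ?count_cat /=; first by rewrite -hn !addnS.
  by rewrite -hn !addnS.
by rewrite add0n.
Qed.

Lemma insert_value a m u : a != 0%N ->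
  count isSome (u ++ map (token r) (a :: m) ++ w0) = n ->
  count (predC isSome) (u ++ map (token r) (a :: m) ++ w0) = 4%N ->
  act (u ++ map (token r) (insert_letter a m) ++ w0) (e q0) =
  act (u ++ map (token r) (a :: m) ++ w0) (e q0).
Proof.
case: a => // a _; elim: m u => //= b m IHm u hn h4; case: ifP => //= hb.
case: b hb hn h4 => //= b hb hn h4.
rewrite swap_letters // -cat_rcons -[in RHS]cat_rcons IHm //=.
  by move: hn; rewrite cat_rcons !count_cat /= !count_cat.
by move: h4; rewrite cat_rcons !count_cat /= !count_cat.
Qed.

Lemma count_insert (a : pred (option Q)) t m :
  count a (map (token r) (insert_letter t m)) = count a (map (token r) (t :: m)).
Proof. by elim: m => //= b m IHm; case: ifP => //= _; rewrite IHm /= addnCA. Qed.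

Lemma count_sort (a : pred (option Q)) m :
  count a (map (token r) (sort_letters m)) = count a (map (token r) m).
Proof.
elim: m => //= t m IHm; case: ifP => /= _; first by rewrite IHm.
by rewrite count_insert /= IHm.
Qed.

Lemma context_ok_sort m : context_ok m -> context_ok (sort_letters m).
Proof. by rewrite /context_ok /context_word !count_cat !count_sort. Qed.

Lemma sort_value m : context_ok m -> context_value (sort_letters m) = context_value m.
Proof.
rewrite /context_ok /context_value /context_word => /andP[/eqP + /eqP].
elim: m u0 => //= a m IHm u hn h4.
case: ifP => [_|/negbT a0] /=; rewrite ?insert_value //=; last first.
- by rewrite -h4 !count_cat /= !count_cat count_sort.
- by rewrite -hn !count_cat /= !count_cat count_sort.
all: by rewrite -!cat_rcons IHm // cat_rcons.
Qed.

Lemma count_token m :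
  (count isSome (map (token r) m) = count (predC1 0%N) m) *
  (count (predC isSome) (map (token r) m) = count (pred1 0%N) m).
Proof. by rewrite !count_map; split; apply: eq_count => -[|t]. Qed.

(** If [p] has value 0 and agrees with [N] times [m] after sorting and killing, then [N] times the
    value of [m] is 0; as [N] is a product of the primes 2, 3 and 5, it cancels. *)
Lemma context_check k l (kill : pred (seq nat)) p ps m :
  (k + count isSome (u0 ++ w0) = n)%N -> (l + count (predC isSome) (u0 ++ w0) = 4)%N ->
  (forall m', context_ok m' -> kill m' -> context_value m' = 0) ->
  pvalue context_value p = 0 -> smooth ps ->
  is_zero (reduce (count_ok k l) kill (p ++ [:: (- (foldr muln 1%N ps)%:Z, m)])) ->
  context_value m = 0.
Proof.
move=> hk hl hkill hp hs /(@pvalue_zero _ context_value).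
have ok m' : count_ok k l m' -> context_ok m'.
  move=> /andP[/eqP h1 /eqP h2]; apply/andP; rewrite -hk -hl /context_word !count_cat !count_token.
  by rewrite h1 h2 addnCA addnA eqxx addnCA addnA.
rewrite pvalue_reduce; last 2 [by move=> m' /ok /sort_value].
  rewrite pvalue_cat hp add0r /pvalue big_seq1 /= mulrNz => /eqP; rewrite oppr_eq0 => /eqP.
  exact: smooth_torsion.
by move=> m' /ok hm' /(hkill _ (context_ok_sort hm')); rewrite sort_value.
Qed.

Lemma pvalue_context p :
  pvalue context_value p = act w0 (peval r p (e (foldl qb q0 u0))).
Proof.
rewrite /peval /pvalue act_sum; apply: eq_bigr => a _.
by rewrite actMz /context_value /context_word !act_cat act_e.
Qed.

End Context.

Section Vanishing.
Variable n : nat.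
Hypothesis IH : forall k, (k < n)%N -> words_vanish k.

(** The first letter is absorbed into the initial one. *)
Lemma vanish_start q p w : count isSome (Some p :: w) = n ->
  count (predC isSome) (Some p :: w) = 4%N -> act (Some p :: w) (e q) = 0.
Proof.
by move=> /= hn h4; rewrite /act /= -e_qb; apply: (@IH n.-1); rewrite -?hn.
Qed.

(** The prefix before the last letter already contains the four [x], with one letter less. *)
Lemma vanish_end q p w : count isSome (rcons w (Some p)) = n ->
  count (predC isSome) (rcons w (Some p)) = 4%N -> act (rcons w (Some p)) (e q) = 0.
Proof.
rewrite -cats1 !count_cat /= !addn0 addn1 => hn h4.
by rewrite act_cat [act w _](@IH n.-1 _ q) ?act0 // -?hn.
Qed.

Lemma kill_start_sound q r w m : context_ok n r [::] w m -> kill_start m ->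
  context_value q r [::] w m = 0.
Proof.
case: m => // -[|t] m // /andP[/eqP h1 /eqP h2] _; exact: vanish_start h1 h2.
Qed.

Lemma kill_end_sound q r u m : context_ok n r u [::] m -> kill_end m ->
  context_value q r u [::] m = 0.
Proof.
rewrite /context_ok /context_value /context_word cats0.
case/lastP: m => // m [|t]; rewrite /kill_end last_rcons // map_rcons -rcons_cat.
by move=> /andP[/eqP h1 /eqP h2] _; apply: vanish_end.
Qed.

(** Linearise at [x, p1, p2, p3]. Arrangements starting with a letter vanish, and the 6 starting
    with [x] agree after sorting. *)
Lemma vanish_left3 q p1 p2 p3 w :
  (3 + count isSome w)%N = n -> count (predC isSome) w = 3%N ->
  act [:: None, Some p1, Some p2, Some p3 & w] (e q) = 0.
Proof.
move=> hn h3; pose r t := nth p1 [:: p1; p1; p1; p2; p3] t.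
apply: (@context_check n q r [::] w IH 3 1 kill_start
   (symp [::] [:: [:: 0]; [:: 2]; [:: 3]; [:: 4]]%N [::]) [:: 2; 3]%N [:: 0; 2; 3; 4]%N) => //.
- by rewrite /= h3.
- by move=> m; apply: kill_start_sound.
- by rewrite pvalue_context peval_symp ?act0.
Qed.

(** The mirror image: arrangements ending in a letter vanish, and 6 equal words ending in [x]
    remain. *)
Lemma vanish_right3 q p1 p2 p3 u :
  (3 + count isSome u)%N = n -> count (predC isSome) u = 3%N ->
  act (u ++ [:: Some p1; Some p2; Some p3; None]) (e q) = 0.
Proof.
move=> hn h3; pose r t := nth p1 [:: p1; p1; p1; p2; p3] t.
apply: (@context_check n q r u [::] IH 3 1 kill_end
   (symp [::] [:: [:: 0]; [:: 2]; [:: 3]; [:: 4]]%N [::]) [:: 2; 3]%N [:: 2; 3; 4; 0]%N) => //.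
- by rewrite cats0.
- by rewrite cats0 h3.
- by move=> m; apply: kill_end_sound.
- by rewrite pvalue_context peval_symp ?act0.
Qed.

(** All 24 arrangements of four adjacent letters agree after sorting. *)
Lemma vanish_middle4 q p1 p2 p3 p4 u w :
  (4 + count isSome (u ++ w))%N = n -> count (predC isSome) (u ++ w) = 4%N ->
  act (u ++ [:: Some p1, Some p2, Some p3, Some p4 & w]) (e q) = 0.
Proof.
move=> hn h3; pose r t := nth p1 [:: p1; p1; p1; p2; p3; p4] t.
apply: (@context_check n q r u w IH 4 0 pred0
   (symp [::] [:: [:: 2]; [:: 3]; [:: 4]; [:: 5]]%N [::]) [:: 2; 2; 2; 3]%N [:: 2; 3; 4; 5]%N) => //.
by rewrite pvalue_context peval_symp ?act0.
Qed.

Definition gap_word (A B C : seq Q) : seq (option Q) :=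
  None :: map Some A ++ None :: map Some B ++ None :: map Some C ++ [:: None].
Definition gap_vanish (z : nat * nat * nat) := forall q A B C,
  (size A, size B, size C) = z -> act (gap_word A B C) (e q) = 0.

Lemma count_gap_word A B C :
  (count isSome (gap_word A B C) = size A + size B + size C)%N *
  (count (predC isSome) (gap_word A B C) = 4%N).
Proof.
have h X : (count isSome (map Some X : seq (option Q)) = size X) *
    (count (predC isSome) (map Some X : seq (option Q)) = 0%N).
  by elim: X => //= x X [-> ->].
rewrite /gap_word /= !count_cat /= !count_cat /= !count_cat /= !h; split=> //.
by rewrite !add0n addn0 addnA.
Qed.

Lemma gap_vanish_large q A B C : (size A + size B + size C)%N = n ->
  [|| 2 < size A, 3 < size B | 2 < size C]%N -> act (gap_word A B C) (e q) = 0.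
Proof.
move=> hn; have [h1 h2] := count_gap_word A B C; rewrite hn in h1.
case/or3P.
- case: A hn h1 h2 => [|p1 [|p2 [|p3 A]]] //= hn h1 h2 _.
  apply: vanish_left3; first by rewrite -h1.
  by move: h2 => [].
- case: B hn h1 h2 => [|p1 [|p2 [|p3 [|p4 B]]]] // hn h1 h2 _.
  have -> : gap_word A [:: p1, p2, p3, p4 & B] C =
     (None :: map Some A ++ [:: None]) ++
        [:: Some p1, Some p2, Some p3, Some p4 & map Some B ++ None :: map Some C ++ [:: None]].
    by rewrite /gap_word /= -catA.
  rewrite /gap_word /= !count_cat /= !count_cat /= in h1 h2.
  apply: vanish_middle4; first by rewrite -h1 /= !count_cat /= !count_cat /=; lia.
  by rewrite -h2 /= !count_cat /= !count_cat /=; lia.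
- case/lastP: C hn h1 h2 => // C p3; case/lastP: C => // C p2; case/lastP: C => // C p1.
  move=> hn h1 h2 _.
  have -> : gap_word A B (rcons (rcons (rcons C p1) p2) p3) =
     (None :: map Some A ++ None :: map Some B ++ None :: map Some C) ++
        [:: Some p1; Some p2; Some p3; None].
    by rewrite /gap_word !map_rcons -!cats1 /= -!catA /= -!catA.
  rewrite /gap_word !map_rcons -!cats1 /= !count_cat /= !count_cat /= !count_cat /= in h1 h2.
  apply: vanish_right3; first by rewrite -h1 /= !count_cat /= !count_cat /=; lia.
  by rewrite /= !count_cat /= !count_cat /=; lia.
Qed.

Variable zs : seq (nat * nat * nat).
Hypothesis zs_vanish : forall z, z \in zs -> gap_vanish z.

Local Notation value q r := (context_value q r [::] [::]).
Local Notation word_ok := (count_ok n 4).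
Local Notation killed := (kill_word zs).

Lemma map_token_letters r A : 0%N \notin A -> map (token r) A = map Some (map r A).
Proof.
elim: A => //= -[|t] A IHA; rewrite inE negb_or //= => hA; by rewrite IHA.
Qed.

Lemma kill_word_sound q r m : context_ok n r [::] [::] m -> killed m -> value q r m = 0.
Proof.
move=> hm /or3P[]; [exact: kill_start_sound|exact: kill_end_sound|].
rewrite /kill_shape; case: (gaps m) => [[A B] C] /and3P[/eqP em].
rewrite !mem_cat !negb_or => /and3P[hA hB hC].
have ew : context_word r [::] [::] m = gap_word (map r A) (map r B) (map r C).
  rewrite /context_word cats0 cat0s em /of_gaps /= !map_cat /= !map_cat /= !map_cat /=.
  by rewrite !map_token_letters.
move: hm; rewrite /context_value /context_ok ew !count_gap_word !size_map => /andP[/eqP hn _].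
case/or4P=> [h|h|h|/zs_vanish h]; last by apply: h; rewrite !size_map.
all: by apply: gap_vanish_large; rewrite !size_map // h ?orbT.
Qed.

Lemma value_peval q r p : pvalue (value q r) p = peval r p (e q).
Proof. exact: pvalue_context. Qed.

(** The part of the word before the token 1 is the class of a single letter, so antisymmetry swaps
    it with the letter 1; its action is then expanded as a Lie polynomial. *)
Lemma exchange_value r s m : s != 0%N -> 1%N \in m ->
  pvalue (value (r 1%N) r) (exchange s m) = value (r s) r m.
Proof.
case: s => // s _ hm; rewrite value_peval /exchange /peval pvalue_opp -/(peval _ _ _).
have em : m = take (index 1%N m) m ++ 1%N :: drop (index 1%N m).+1 m.
  by rewrite -[X in X :: _](nth_index 0%N hm) -drop_nth ?index_mem // cat_take_drop.
move: (take _ m) (drop _ m) em => w1 w2 ->; rewrite peval_mul peval_word peval_liep //.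
rewrite /context_value /context_word cats0 cat0s map_cat act_cat act_e /= /act /=.
by rewrite [in RHS]T_anti -!/(act _ _) actN.
Qed.

Lemma word_ok_context r m : word_ok m -> context_ok n r [::] [::] m.
Proof.
by rewrite /context_ok /context_word cats0 cat0s !count_token => /andP[-> ->].
Qed.

Lemma relation_value r R :
  pvalue (value (r 1%N) r) (relation_poly word_ok (prefix_ok n) killed R) = 0.
Proof.
have nil0 : pvalue (value (r 1%N) r) [::] = 0 by rewrite /pvalue big_nil.
case: R => [s m gs m'|s m]; rewrite /relation_poly.
  case: ifP => // /negbFE hgs; case: eqP => [_|_]; first by rewrite value_peval peval_symp.
  case: ifP => // /andP[s0 /allP h1]; rewrite pvalue_flatten big_map big_seq.
  rewrite (eq_bigr (fun a : int * seq nat => value (r s) r a.2 *~ a.1)); last first.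
    by move=> a /h1 ha; rewrite pvalue_scale exchange_value.
  rewrite -big_seq -/(pvalue (value (r s) r) _) pvalue_reduce.
  - by rewrite value_peval peval_symp.
  - by move=> a /word_ok_context -/(_ r) ha; rewrite (sort_value _ IH ha).
  move=> a /word_ok_context -/(_ r) ha hk; rewrite -(sort_value _ IH ha).
  by apply: kill_word_sound hk; apply: context_ok_sort.
case: ifP => // /andP[/andP[s0 /andP[n0 /andP[/eqP k1 /eqP k2]]] m1].
rewrite exchange_value // ?mem_rcons ?inE ?eqxx //.
rewrite /context_value /context_word cats0 cat0s -cats1 map_cat act_cat.
rewrite [act (map _ m) _](@IH n.-1 _ (r s)) ?act0 ?count_token ?prednK //.
Qed.

Lemma certificate abc cert ps : (abc.1.1 + abc.1.2 + abc.2)%N = n ->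
  check_certificate zs abc cert ps -> gap_vanish abc.
Proof.
case: abc => [[a b] c] /= hn; rewrite /check_certificate hn => /andP[hps hz] q A B C [hA hB hC].
(* Token 1 is the initial letter [q], and the tokens from 2 on are the letters of the gaps in order.
   Index 0 is a filler, since token 0 denotes [x]. *)
pose r t := nth q (q :: q :: A ++ B ++ C) t.
have hit k l (X : seq Q) : X = take l (drop k (q :: q :: A ++ B ++ C)) -> size X = l ->
    map r (iota k l) = X.
  move=> eX sX; apply: (@eq_from_nth _ q); rewrite size_map size_iota // => i hi.
  by rewrite (nth_map 0%N) ?size_iota // nth_iota // /r eX nth_take // nth_drop.
have no0 k l : (0 < k)%N -> 0%N \notin iota k l.
  by move=> k0; rewrite mem_iota negb_and -ltnNge k0.
have -> : gap_word A B C = context_word r [::] [::] (gap_target a b c).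
  rewrite /context_word cats0 cat0s /gap_target /of_gaps /= !map_cat /= !map_cat /= !map_cat /=.
  rewrite !map_token_letters ?no0 // (hit 2 a A) ?(hit _ b B) ?(hit _ c C) //.
  - by rewrite -addnA /= -hA -hB catA -size_cat drop_size_cat // -hC take_size.
  - by rewrite /= -hA drop_size_cat // -hB take_size_cat.
  - by rewrite /= drop0 -hA take_size_cat.
apply: (context_check IH (k := n) (l := 4) (kill := killed) _ _ _ _ hps hz) => //.
- by rewrite addn0.
- by move=> m; apply: kill_word_sound.
rewrite pvalue_flatten big_map big1 // => x _.
by rewrite pvalue_scale -[q]/(r 1%N) relation_value mul0rz.
Qed.

End Vanishing.


Lemma check_all_sound n zs cs : (forall k, (k < n)%N -> words_vanish k) ->
  all (fun z => z.1.1 + z.1.2 + z.2 == n)%N [seq c.1.1 | c <- cs] ->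
  (forall z, z \in zs -> gap_vanish z) -> check_all zs cs ->
  forall z, z \in [seq c.1.1 | c <- cs] -> gap_vanish z.
Proof.
move=> IH; elim: cs zs => // -[[abc cert] ps] cs IHcs zs /= /andP[/eqP habc hcs] hzs /andP[hc hall].
have habc' : gap_vanish abc by apply: certificate IH _ hzs _ _ _ habc hc.
move=> z; rewrite inE => /orP[/eqP->//|]; apply: IHcs hall z => // z.
by rewrite inE => /orP[/eqP->|/hzs].
Qed.

Lemma split_gap w k : count (predC isSome) w = k.+1 ->
  exists A w', w = map Some A ++ None :: w' /\ count (predC isSome) w' = k.
Proof.
elim: w => //= -[a|] w IHw /=; last by rewrite add1n => -[<-]; exists [::], w.
by rewrite add0n => /IHw [A [w' [-> hw']]]; exists (a :: A), w'.
Qed.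

Lemma no_gap w : count (predC isSome) w = 0%N -> exists A, w = map Some A.
Proof.
elim: w => [|[a|] w IHw] //=; first by exists [::].
by rewrite add0n => /IHw [A ->]; exists (a :: A).
Qed.

Lemma words_vanish_level n : (forall k, (k < n)%N -> words_vanish k) -> words_vanish n.
Proof.
move=> IH q w hn h4.
have : level_check n by have [/level_check_small|/level_check_large] := ltnP n 8.
move=> /and3P[hs hc /allP hcov].
have hz := check_all_sound IH hs (fun z (h : z \in [::]) => False_ind _ (notF h)) hc.
have [A0 [w1 [e1 h1]]] := split_gap h4.
have [A [w2 [e2 h2]]] := split_gap h1.
have [B [w3 [e3 h3]]] := split_gap h2.
have [C [w4 [e4 h5]]] := split_gap h3.
have [A4 e5] := no_gap h5.
case: A0 e1 => [|a A0] e1; last first.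
  by rewrite e1; apply: (vanish_start IH); [rewrite -hn e1 | rewrite -h4 e1].
case/lastP: A4 e5 => [|A4 a] e5; last first.
  have ew : w = rcons (None :: map Some A ++ None :: map Some B ++ None :: map Some C ++
                   None :: map Some A4) (Some a).
    by rewrite e1 e2 e3 e4 e5 map_rcons -!cats1 /= -!catA /= -!catA /= -!catA.
  by rewrite ew; apply: (vanish_end IH); rewrite -?ew.
have ew : w = gap_word A B C by rewrite e1 e2 e3 e4 e5.
rewrite ew in hn *; rewrite count_gap_word in hn.
have [hl|] := boolP [|| 2 < size A, 3 < size B | 2 < size C]%N.
  exact: gap_vanish_large IH _ _ _ _ hn hl.
rewrite !negb_or -!leqNgt => /and3P[hA hB hC].
apply: (hz (size A, size B, size C)) => //; apply: hcov.
rewrite mem_filter; apply/andP; split; first by rewrite /= hn.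
apply/allpairsP; exists ((size A, size B), size C).
split; rewrite ?mem_iota //.
by apply/allpairsP; exists (size A, size B); split; rewrite ?mem_iota.
Qed.

(** A word with more than four [x] has a prefix with exactly four, which vanishes already. *)
Theorem long_words_vanish q w : (4 <= count (predC isSome) w)%N -> act w (e q) = 0.
Proof.
have H n : words_vanish n.
  by elim/ltn_ind: n => n IH; apply: words_vanish_level.
elim/last_ind: w => // w z IHw; rewrite -cats1 count_cat /= addn0.
have [hlt|hge _] := ltnP (count (predC isSome) w) 4; last by rewrite act_cat IHw ?act0.
move=> h; apply: (H _ q _ erefl); rewrite count_cat /= addn0.
by apply/eqP; rewrite eqn_leq h andbT; case: z {h} => [z|] /=; lia.
Qed.

End LieWords.

Local Open Scope group_scope.

(** * The graded Lie ring satisfies the Engel identity *)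

Section GradedLie.
Variables (G : groupType) (J : finType) (gens : J -> G -> Prop) (d0 : J).
Implicit Types (m n p : J -> nat) (g h : G).
Local Notation filt := (filt gens).
Local Notation D := (ideal_degree d0).
Local Notation cls := (@cls G J gens d0).
Local Notation gact := (@gact G J gens d0).
Local Notation letter := (letter gens).
Implicit Type z : letter.

Definition lcomm z z' : letter := Letter (filt_comm (lfilt z) (lfilt z')).

Lemma gact_comm z z' m g : D m -> filt m g ->
  gact (lcomm z z') (cls m g) = (gact z' (gact z (cls m g)) - gact z (gact z' (cls m g)))%R.
Proof.
move=> Dm hg; have hz := lfilt z; have hz' := lfilt z'.
rewrite !gact_cls //=; try by [apply: ideal_degree_addl | apply: filt_comm].
have Da := ideal_degree_addl (ldeg z') (ideal_degree_addl (ldeg z) Dm).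
have -> : addm (addm m (ldeg z')) (ldeg z) = addm (addm m (ldeg z)) (ldeg z').
  by rewrite -!addmA (addmC (ldeg z)).
rewrite -addmA in Da *; have h1 : filt (addm m (addm (ldeg z) (ldeg z'))) [~ [~ g, lelt z], lelt z'].
  by rewrite addmA; apply: filt_comm => //; apply: filt_comm.
have h2 : filt (addm m (addm (ldeg z) (ldeg z'))) [~ [~ g, lelt z'], lelt z].
  by rewrite (addmC (ldeg z)) addmA; apply: filt_comm => //; apply: filt_comm.
rewrite -cls_inv // -cls_mul //; last exact: filt_inv.
apply: cls_mod => //.
- by apply: filt_comm => //; apply: filt_comm.
- by rewrite addmA; exact: (Jacobi_mod Dm).
- by apply: filt_mul (filt_inv h2).
Qed.

Lemma gact_anti z z' : D (ldeg z) -> D (ldeg z') ->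
  gact z' (cls (ldeg z) (lelt z)) = (- gact z (cls (ldeg z') (lelt z')))%R.
Proof.
move=> Dz Dz'; rewrite !gact_cls //; try exact: lfilt.
rewrite addmC -cls_inv ?invgR //; first exact: ideal_degree_addl.
by apply: filt_comm; apply: lfilt.
Qed.

Definition fold_deg (zs : nat -> letter) m (t : seq nat) :=
  foldl (fun m i => addm m (ldeg (zs i))) m t.

Lemma fold_degE zs m t k : fold_deg zs m t k = (m k + \sum_(i <- t) ldeg (zs i) k)%N.
Proof.
elim: t m => [|i t IH] m; first by rewrite big_nil addn0.
by rewrite /= IH big_cons addnA.
Qed.

Definition gacts (zs : nat -> letter) u (t : seq nat) := foldl (fun v i => gact (zs i) v) u t.

Lemma gacts_cls zs m g t : D m -> filt m g ->
  [/\ gacts zs (cls m g) t = cls (fold_deg zs m t) (foldl (fun f i => [~ f, lelt (zs i)]) g t),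
    D (fold_deg zs m t) & filt (fold_deg zs m t) (foldl (fun f i => [~ f, lelt (zs i)]) g t)].
Proof.
elim: t m g => // i t IH m g Dm hg; rewrite /gacts /= gact_cls //.
by apply: IH; [apply: ideal_degree_addl | apply: filt_comm (lfilt _)].
Qed.

Lemma gactsD zs t : {morph gacts zs ^~ t : u v / (u + v)%R}.
Proof. by elim: t => // i t IH u v; rewrite /gacts /= gactD; apply: IH. Qed.

Lemma gact0 z : gact z 0%R = 0%R.
Proof. by apply: (addIr (gact z 0%R)); rewrite -gactD !add0r. Qed.
Lemma gactN z u : gact z (- u)%R = (- gact z u)%R.
Proof. by apply: (addrI (gact z u)); rewrite -gactD !subrr gact0. Qed.
Lemma gacts0 zs t : gacts zs 0%R t = 0%R.
Proof. by elim: t => // i t IH; rewrite /gacts /= gact0. Qed.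
Lemma gactsN zs t u : gacts zs (- u)%R t = (- gacts zs u t)%R.
Proof. by apply: (addrI (gacts zs u t)); rewrite -gactsD !subrr gacts0. Qed.

Definition engel_sum u := forall zs, (\sum_(t <- perms4) gacts zs u t)%R = 0%R.

Lemma perms4P : all (fun t => perm_eq t (iota 1 4)) perms4.
Proof. by vm_compute. Qed.

Definition bracket_at (zs : nat -> letter) (h : letter) i : nat -> letter :=
  fun j => if j == i then lcomm (zs i) h else zs j.

Lemma gacts_bracket_at zs (h : letter) i u t : i \notin t -> gacts (bracket_at zs h i) u t = gacts zs u t.
Proof.
elim: t u => // j t IH u; rewrite inE negb_or => /andP[ij it].
rewrite /gacts /= [bracket_at _ _ _ j](_ : _ = zs j); first exact: IH.
by rewrite /bracket_at eq_sym (negPf ij).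
Qed.

(** The derivation rule for [h]. Since [t] has no repetition, changing [zs] at index [i] alters
    exactly one position of the word. *)
Lemma gacts_commute zs (h : letter) m g t : uniq t -> D m -> filt m g ->
  gacts zs (gact h (cls m g)) t =
  (gact h (gacts zs (cls m g) t) - \sum_(i <- t) gacts (bracket_at zs h i) (cls m g) t)%R.
Proof.
elim: t m g => [|i t IH] m g; first by rewrite big_nil subr0.
move=> /= /andP[it ut] Dm hg; rewrite /gacts /= -!/(gacts _ _ _).
have -> : gact (zs i) (gact h (cls m g)) =
    (gact h (gact (zs i) (cls m g)) - gact (lcomm (zs i) h) (cls m g))%R.
  by rewrite gact_comm // subKr.
rewrite gactsD gactsN gact_cls // IH //; [|exact: ideal_degree_addl|exact: filt_comm (lfilt _)].
rewrite -gact_cls // big_cons opprD addrA addrAC; congr (_ + _ + _)%R.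
  congr (- _)%R; apply: eq_big_seq => j jt.
  rewrite /gacts /= [bracket_at _ _ j i](_ : _ = zs i) // /bracket_at.
  by case: eqP => // e; rewrite e jt in it.
rewrite [bracket_at _ _ i i](_ : _ = lcomm (zs i) h); last by rewrite /bracket_at eqxx.
by rewrite -/(gacts (bracket_at zs h i) _ t) gacts_bracket_at.
Qed.

(** For each fixed [i], the corrections of the derivation rule, summed over the arrangements, are
    the identity for the same class at the letters [bracket_at zs h i]. *)
Lemma engel_sum_gact (h : letter) m g : D m -> filt m g -> engel_sum (cls m g) ->
  engel_sum (gact h (cls m g)).
Proof.
move=> Dm hg hE zs.
rewrite (eq_big_seq (fun t => gact h (gacts zs (cls m g) t) -
   \sum_(i <- iota 1 4) gacts (bracket_at zs h i) (cls m g) t)%R); last first.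
  move=> t /(allP perms4P) tp; rewrite gacts_commute //; last first.
    by rewrite (perm_uniq tp) iota_uniq.
  by congr (_ - _)%R; apply: perm_big.
rewrite sumrB exchange_big [X in (_ - X)%R]big1 ?subr0; last by move=> i _; apply: hE.
by rewrite -(big_morph (gact h) (gactD h) (gact0 h)) hE gact0.
Qed.

Hypothesis gens_engel : forall g, gens d0 g -> forall h, iter 4 (fun f => [~ f, h]) g = 1.

Lemma engel_sum_gen g : gens d0 g -> engel_sum (cls (unitm d0) g).
Proof.
move=> hg zs.
have Du : D (unitm d0) by rewrite /ideal_degree /unitm eqxx.
have fu : filt (unitm d0) g by apply: filt_gen.
pose c i := if i is 0 then g else lelt (zs i).
pose p i := if i is 0 then unitm d0 else ldeg (zs i).
have hc i : (i < 5)%N -> filt (p i) (c i) by case: i => // i _; apply: lfilt.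
have /= := engel_linearization hc (gens_engel hg).
set k := eval_degree _ _ => hk.
have kE t : t \in perms4 -> fold_deg zs (unitm d0) t = k.
  move=> /(allP perms4P) tp; apply/funext => j; rewrite fold_degE (perm_big _ tp) /=.
  by rewrite /k /eval_degree !big_ord_recl big_ord0 !big_cons big_nil /= !mul1n.
pose F t := foldl (fun f i => [~ f, c i]) g t.
have foldE t g' : 0%N \notin t ->
    foldl (fun f i => [~ f, c i]) g' t = foldl (fun f i => [~ f, lelt (zs i)]) g' t.
  by elim: t g' => //= -[|i] t IH g'; rewrite inE //= => /IH->.
have FE t : t \in perms4 -> F t = foldl (fun f i => [~ f, lelt (zs i)]) g t.
  by move=> /(allP perms4P) /perm_mem tp; apply: foldE; rewrite tp.
have HF t : t \in perms4 -> D k /\ filt k (F t).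
  move=> ht; have [_ h1 h2] := gacts_cls zs t Du fu.
  by rewrite -(kE t ht) FE.
rewrite (eq_big_seq (fun t => cls k (F t))); last first.
  by move=> t ht; have [-> _ _] := gacts_cls zs t Du fu; rewrite kE // FE.
have p4 : [:: 1; 2; 3; 4]%N \in perms4 by vm_compute.
have [Dk _] := HF _ p4.
have : (\sum_(t <- perms4) cls k (F t))%R = cls k (\prod_(t <- perms4) F t) /\
       filt k (\prod_(t <- perms4) F t).
  have : forall t, t \in perms4 -> filt k (F t) by move=> t /HF[].
  elim: (perms4) => [|t s IH] hs; first by rewrite !big_nil cls1; split=> //; apply: filt_one (ideal_degree_nzm Dk).
  rewrite !big_cons; have [|-> fs] := IH; first by move=> u us; apply: hs; rewrite inE us orbT.
  have ft : filt k (F t) by apply: hs; rewrite inE eqxx.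
  by split; [rewrite cls_mul | apply: filt_mul].
by move=> [-> fk]; apply/cls_eq0 => //; apply: torsion_ltm.
Qed.

(** In a commutator of ideal degree at least one entry has ideal degree; antisymmetry brings that
    entry to the left, where the previous stability applies. *)
Lemma engel_sum_filt m g : filt m g -> D m -> engel_sum (cls m g).
Proof.
elim=> [j h hg|n nz|n h h' fh IHh fh' IHh'|n h fh IHh|n n' h h' fh IHh fh' IHh'|n n' h fh IH nz le] Dm.
- have <- : d0 = j by move: Dm; rewrite /ideal_degree /unitm; case: eqP.
  apply: engel_sum_gen; suff -> : d0 = j by [].
  by move: Dm; rewrite /ideal_degree /unitm; case: eqP.
- by move=> zs; rewrite cls1 big1 // => t _; apply: gacts0.
- move=> zs; rewrite cls_mul // (eq_bigr _ (fun t _ => gactsD zs t _ _)) big_split /=.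
  by rewrite IHh // IHh' // addr0.
- move=> zs; rewrite cls_inv // (eq_bigr _ (fun t _ => gactsN zs t _)) sumrN.
  by rewrite IHh // oppr0.
- have [Dn|Dn] := boolP (D n).
    have -> : cls (addm n n') [~ h, h'] = gact (Letter fh') (cls n h) by rewrite gact_cls.
    by apply: engel_sum_gact => //; apply: IHh.
  have Dn' : D n' by move: Dm Dn; rewrite /ideal_degree /addm; lia.
  have -> : cls (addm n n') [~ h, h'] = (- gact (Letter fh) (cls n' h'))%R.
    rewrite gact_cls //= (addmC n') -cls_inv ?invgR //.
    by rewrite addmC; apply: filt_comm.
  move=> zs; rewrite (eq_bigr _ (fun t _ => gactsN zs t _)) sumrN.
  by rewrite engel_sum_gact ?oppr0 //; apply: IHh'.
(* An element whose degree has been strictly weakened has class zero; otherwise the two degrees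
   coincide. *)
- have [e|ne] := pselect (exists j, (n' j < n j)%N).
    have lt : ltm n' n by split.
    move=> zs; have fh' := filt_le fh nz le.
    have -> : cls n' h = 0%R.
      by apply/cls_eq0 => //; apply: torsion_ltm; apply: nset_base lt fh.
    by rewrite big1 // => t _; apply: gacts0.
  have <- : n = n'.
    apply/funext => j; apply/eqP; rewrite eqn_leq le andbT leqNgt; apply/negP => h1.
    by apply: ne; exists j.
  by apply: IH; apply: leq_trans Dm (le _).
Qed.

End GradedLie.

(** * The ideal generated by [a] and [b] in the Lie ring on [a], [b], [x] *)

Section ThreeGenerators.
Variables (G : groupType) (a b x : G).

Definition abx_gens (j : bool) (g : G) : Prop := if j then g = x else g = a \/ g = b.

Hypothesis ab_engel : forall g, abx_gens false g -> forall h, iter 4 (fun f => [~ f, h]) g = 1.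

Local Notation filt := (filt abx_gens).
Local Notation D := (@ideal_degree bool false).
Local Notation cls := (@cls G bool abx_gens false).
Local Notation gact := (@gact G bool abx_gens false).
Local Notation letter := (letter abx_gens).
Local Notation graded := (graded abx_gens false).

Definition x_letter : letter := Letter (@filt_gen G bool abx_gens true x erefl).
Definition ideal_letter := {z : letter | D (ldeg z)}.
Definition to_letter (o : option ideal_letter) : letter :=
  if o is Some q then sval q else x_letter.
Definition letter_act (o : option ideal_letter) : graded -> graded := gact (to_letter o).
Definition letter_cls (q : ideal_letter) : graded := cls (ldeg (sval q)) (lelt (sval q)).
Definition letter_bracket (q : ideal_letter) (o : option ideal_letter) : ideal_letter :=
  exist _ (lcomm (sval q) (to_letter o)) (ideal_degree_addl (ldeg (to_letter o)) (svalP q)).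

Lemma letter_cls_bracket q o : letter_cls (letter_bracket q o) = letter_act o (letter_cls q).
Proof. by rewrite /letter_act gact_cls //; [apply: (svalP q) | apply: lfilt]. Qed.

Local Notation act := (act letter_act).

Lemma deep_word_vanish q w : (4 <= count (predC isSome) w)%N -> act w (letter_cls q) = 0%R.
Proof.
apply: (@long_words_vanish graded ideal_letter letter_act letter_cls letter_bracket).
- by move=> o; apply: gactD.
- exact: letter_cls_bracket.
- by move=> q1 o r; apply: gact_comm (svalP r) (lfilt (sval r)).
- by move=> q1 r; apply: gact_anti (svalP q1) (svalP r).
- move=> q1 z; apply: (engel_sum_filt ab_engel (lfilt (sval q1)) (svalP q1)
    (fun i => to_letter (z i))).
- by move=> p v; apply: graded_torsion_free.
Qed.

(** Only the explicit operators [x] are counted, not those hidden inside letters. The vanishing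
    theorem speaks of such words, so a class of [x]-degree [k] has to be unfolded into words with
    [k] explicit [x]. *)
Inductive word_span (k : nat) : graded -> Prop :=
| word_span0 : word_span k 0%R
| word_spanD u v : word_span k u -> word_span k v -> word_span k (u + v)%R
| word_spanN u : word_span k u -> word_span k (- u)%R
| word_span_act q w : count (predC isSome) w = k -> word_span k (act w (letter_cls q)).

Lemma word_span_vanish k u : (4 <= k)%N -> word_span k u -> u = 0%R.
Proof.
move=> hk; elim=> // [u1 v _ -> _ ->|u1 _ ->|q w hw]; rewrite ?addr0 ?oppr0 //.
by apply: deep_word_vanish; rewrite hw.
Qed.

Lemma word_cls q w : exists q', act w (letter_cls q) = letter_cls q'.
Proof.
exists (foldl letter_bracket q w); apply: act_e; exact: letter_cls_bracket.
Qed.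

Lemma letter_eq n h (f1 f2 : filt n h) : Letter f1 = Letter f2.
Proof. by congr Letter; apply: Prop_irrelevance. Qed.

Lemma gact_span_ext k l z :
  (forall q w, count (predC isSome) w = k -> word_span l (gact z (act w (letter_cls q)))) ->
  forall u, word_span k u -> word_span l (gact z u).
Proof.
move=> h u; elim=> [|u1 v _ h1 _ h2|u1 _ h1|q w hw]; last exact: h.
- by rewrite gact0; apply: word_span0.
- by rewrite gactD; apply: word_spanD.
- by rewrite gactN; apply: word_spanN.
Qed.

(** The Jacobi identity unfolds commutation with a composite element down to the generators; [x]
    adds one explicit operator and [a], [b] add letters. The second proof [fh] is kept general
    because a [letter] contains one, while the induction consumes the first. *)
Lemma gact_span n h : filt n h -> forall (fh : filt n h) k u, word_span k u ->
  word_span (k + n true) (gact (Letter fh) u).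
Proof.
elim=> [j h' hg|n1 nz|n1 h1 h2 f1 IH1 f2 IH2|n1 h1 f1 IH1|n1 n2 h1 h2 f1 IH1 f2 IH2|n1 n2 h1 f1 IH1 nz le] fh k;
  apply: gact_span_ext => q w hw.
- case: j hg fh => [hg|hg] fh.
    have -> : Letter fh = x_letter by rewrite /x_letter; case: _ / (esym hg) fh => fh; apply: letter_eq.
    rewrite [gact _ _](_ : _ = act (rcons w None) (letter_cls q)); last by rewrite -cats1 act_cat.
    by apply: word_span_act; rewrite -cats1 count_cat hw.
  have Du : D (ldeg (Letter fh)) by rewrite /ideal_degree.
  rewrite [gact _ _](_ : _ = act (rcons w (Some (exist _ (Letter fh) Du))) (letter_cls q)).
    by apply: word_span_act; rewrite -cats1 count_cat hw.
  by rewrite -cats1 act_cat.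
- have [[z Dz] ->] := word_cls q w.
  by rewrite gact_cls ?commg1 ?cls1; [apply: word_span0 | | apply: lfilt].
- have [[z Dz] eq'] := word_cls q w; have hz := lfilt z.
  have -> : gact (Letter fh) (act w (letter_cls q)) =
    (gact (Letter f2) (act w (letter_cls q)) + gact (Letter f1) (act w (letter_cls q)))%R.
    rewrite eq' !gact_cls //= -cls_mul; [|exact: ideal_degree_addl|exact: filt_comm|exact: filt_comm].
    apply: cls_mod; [exact: ideal_degree_addl|exact: filt_comm|exact: commgM_mod|].
    by apply: filt_mul; apply: filt_comm.
  by apply: word_spanD; [apply: IH2 | apply: IH1]; apply: word_span_act.
- have [[z Dz] eq'] := word_cls q w; have hz := lfilt z.
  have -> : gact (Letter fh) (act w (letter_cls q)) = (- gact (Letter f1) (act w (letter_cls q)))%R.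
    rewrite eq' !gact_cls //=; apply/eqP; rewrite -subr_eq0 opprK -cls_mul;
      [|exact: ideal_degree_addl|exact: filt_comm|exact: filt_comm].
    rewrite -(cls1 _ _ (addm (ldeg z) n1)) -(commg1 (lelt z)) -(mulgV h1); apply/eqP/esym.
    apply: cls_mod; [exact: ideal_degree_addl| |exact: commgM_mod|].
      by rewrite mulgV commg1; apply: filt_one (ideal_degree_nzm (ideal_degree_addl _ Dz)).
    by apply: filt_mul; apply: filt_comm.
  by apply: word_spanN; apply: IH1; apply: word_span_act.
- have [[z Dz] eq'] := word_cls q w; have hz := lfilt z.
  rewrite (letter_eq fh (filt_comm f1 f2)) -/(lcomm (Letter f1) (Letter f2)).
  have := gact_comm (Letter f1) (Letter f2) Dz hz.
  rewrite -[cls _ _]/(letter_cls (exist _ z Dz)) -eq' => ->.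
  rewrite /addm; apply: word_spanD; last apply: word_spanN.
    by rewrite addnA; apply: IH2; apply: IH1; apply: word_span_act.
  by rewrite (addnC (n1 true)) addnA; apply: IH1; apply: IH2; apply: word_span_act.
- have [e|ne] := pselect (exists j, (n2 j < n1 j)%N).
    have [[z Dz] ->] := word_cls q w; have hz := lfilt z.
    rewrite gact_cls //= (_ : cls _ _ = 0%R); first by apply: word_span0.
    apply/cls_eq0; [exact: ideal_degree_addl|exact: filt_comm|]; apply: torsion_ltm.
    apply: nset_base (filt_comm hz f1); apply: lt_addl; first exact: lem_refl.
    by split.
  have e : n1 = n2.
    apply/funext => j; apply/eqP; rewrite eqn_leq le andbT leqNgt; apply/negP => hj.
    by apply: ne; exists j.
  by case: _ / e fh {nz le ne} => fh; apply: IH1; apply: word_span_act.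
Qed.

Lemma cls_span m g : filt m g -> D m -> word_span (m true) (cls m g).
Proof.
elim=> [j h hg|n nz|n h h' fh IHh fh' IHh'|n h fh IHh|n n' h h' fh IHh fh' IHh'|n n' h fh IH nz le] Dm.
- case: j hg Dm => // hg Du; have fh := filt_gen hg.
  by apply: (@word_span_act 0 (exist _ (Letter fh) Du) [::]).
- by rewrite cls1; apply: word_span0.
- by rewrite cls_mul //; apply: word_spanD; [apply: IHh | apply: IHh'].
- by rewrite cls_inv //; apply: word_spanN; apply: IHh.
- have [Dn|Dn] := boolP (D n).
    have -> : cls (addm n n') [~ h, h'] = gact (Letter fh') (cls n h) by rewrite gact_cls.
    by apply: gact_span => //; apply: IHh.
  have Dn' : D n' by move: Dm Dn; rewrite /ideal_degree /addm; lia.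
  have -> : cls (addm n n') [~ h, h'] = (- gact (Letter fh) (cls n' h'))%R.
    rewrite gact_cls //= (addmC n') -cls_inv ?invgR //.
    by rewrite addmC; apply: filt_comm.
  apply: word_spanN; rewrite /addm addnC; apply: gact_span => //; exact: IHh'.
- have [e|ne] := pselect (exists j, (n' j < n j)%N).
    rewrite (_ : cls n' h = 0%R); first by apply: word_span0.
    apply/cls_eq0 => //; first exact: filt_le fh nz le.
    by apply: torsion_ltm; apply: nset_base fh; split.
  have e : n = n'.
    apply/funext => j; apply/eqP; rewrite eqn_leq le andbT leqNgt; apply/negP => hj.
    by apply: ne; exists j.
  by rewrite -e in Dm *; apply: IH.
Qed.

Hypothesis torsion_free : forall (g : G) k, g ^+ (30 ^ k) = 1 -> g = 1.
Variable c : nat.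
Hypothesis nilpotent : forall m g, filt m g -> (c < m false + m true)%N -> g = 1.

(** The class of [g] vanishes, so some [g ^+ (30 ^ l)] is a product of elements of strictly higher
    bidegree. These are trivial by induction on the distance to the nilpotency class, and
    torsion-freeness gives [g = 1]. *)
Lemma deep_filt_trivial m g : filt m g -> (0 < m false)%N -> (3 < m true)%N -> g = 1.
Proof.
have [k] := ubnP (c.+1 - (m false + m true)).
elim: k m g => // k IH m g hk fm m0 m1.
have [/(nilpotent fm)//|le] := ltnP c (m false + m true).
have [l hl] : torsion abx_gens m g.
  by apply/(@cls_eq0 _ _ _ false) => //; apply: word_span_vanish m1 (cls_span fm m0).
apply: (torsion_free (k := l)); elim: hl => // m' g1 h1 [lem' [j ltj]] fg1 _ ->.
rewrite mulg1; have l0 := lem' false; have l1 := lem' true.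
apply: IH fg1 _ _; [|exact: leq_trans l0|exact: leq_trans l1].
by case: j ltj => ltj; lia.
Qed.

End ThreeGenerators.

(** * Lower central series *)

From mathcomp Require Import all_classical.

Local Open Scope classical_set_scope.
Local Open Scope group_scope.

Section LowerCentral.
Variables (G : groupType) (H : set G).
Hypothesis subH : is_subgroup H.
Local Notation LC := (lower_central H).

Lemma gen_subgroup (A : set G) : is_subgroup (gen A).
Proof.
split=> [K [[]]//|y z hy hz K hK|y hy K hK].
- by case: (hK) => -[_ hM _] _; apply: hM; [apply: hy | apply: hz].
- by case: (hK) => -[_ _ hV] _; apply: hV; apply: hy.
Qed.

Lemma gen_min (A K : set G) : is_subgroup K -> (forall z, A z -> K z) -> forall z, gen A z -> K z.
Proof. by move=> hK sAK z; apply; split. Qed.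

Lemma sub_gen (A : set G) z : A z -> gen A z.
Proof. by move=> hz K [_ sAK]; apply: sAK. Qed.

Lemma LC_subgroup i : is_subgroup (LC i).
Proof. by case: i => // i; apply: gen_subgroup. Qed.
Lemma LC1 i : LC i 1. Proof. by case: (LC_subgroup i). Qed.
Lemma LCM i y z : LC i y -> LC i z -> LC i (y * z).
Proof. by case: (LC_subgroup i) => _ + _; apply. Qed.
Lemma LCV i y : LC i y -> LC i y^-1.
Proof. by case: (LC_subgroup i) => _ _; apply. Qed.

Lemma LC_commH i y h : LC i y -> H h -> LC i.+1 [~ y, h].
Proof. by move=> hy hh; apply: sub_gen; exists y, h. Qed.

Lemma LC_conj i y h : LC i y -> H h -> LC i (y ^ h).
Proof.
move=> + hh; elim: i y => [|i IH] y.
  by move=> hy; rewrite conjgE; apply: (@LCM 0); [apply: (@LCV 0) | apply: (@LCM 0)].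
apply: (gen_min (K := [set z | LC i.+1 (z ^ h)])).
  split=> /= [|z z' hz hz'|z hz]; rewrite ?conj1g ?conjMg ?conjVg.
  - exact: (LC1 i.+1).
  - exact: (@LCM i.+1).
  - exact: (@LCV i.+1).
move=> z [u [k [hu hk ->]]] /=; rewrite conjRg; apply: LC_commH (IH _ hu) _.
by rewrite conjgE; apply: (@LCM 0); [apply: (@LCV 0) | apply: (@LCM 0)].
Qed.

Lemma LC_decr i y : LC i.+1 y -> LC i y.
Proof.
apply: gen_min; first exact: LC_subgroup.
by move=> z [u [h [hu hh ->]]]; rewrite commgEl; apply: LCM (LCV hu) (LC_conj hu hh).
Qed.

Lemma LC_le i j y : (i <= j)%N -> LC j y -> LC i y.
Proof. by move=> /subnK <-; elim: (j - i)%N => // k IH /LC_decr. Qed.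

Lemma LC_H i y : LC i y -> H y. Proof. exact: (@LC_le 0). Qed.

(** The three subgroups argument, carried out on elements; the successor is due to indexing from
    0. *)
Lemma LC_comm i j g h : LC i g -> LC j h -> LC (i + j).+1 [~ g, h].
Proof.
elim: j i g h => [|j IH] i g h hg; first by rewrite addn0; apply: LC_commH.
suff : forall z, LC j.+1 z -> H z /\ LC (i + j.+1).+1 [~ z, g].
  by move=> hs /hs [_ hz]; rewrite -invgR; apply: LCV.
apply: (gen_min (K := [set z | H z /\ LC (i + j.+1).+1 [~ z, g]])).
  split=> /= [|z z' [Hz hz] [Hz' hz']|z [Hz hz]].
  - by rewrite comm1g; split; [apply: (LC1 0) | apply: (LC1 (i + j.+1).+1)].
  - split; first exact: (@LCM 0).
    by rewrite commMg; apply: (@LCM (i + j.+1).+1) => //; apply: (@LC_conj (i + j.+1).+1).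
  - split; first exact: (@LCV 0).
    rewrite commVg_err; apply: (@LC_conj (i + j.+1).+1); last exact: (@LCV 0).
    exact: (@LCV (i + j.+1).+1).
move=> z [y [k [hy hk ->]]] /=; split; first exact: LC_H (LC_commH hy hk).
have Hg := LC_H hg; have Hy := LC_H hy; have hk' := @LCV 0 _ hk.
(* The induction hypothesis, with [i.+1] for the first factor and [i] for the second, places these
   two deep enough; the third is the wanted commutator up to conjugation. *)
have := Hall_Witt y k^-1 g; rewrite invgK.
set u := [~ [~ k^-1, g^-1], y] ^ g; set v := [~ [~ g, y^-1], k^-1] ^ y.
have hu : LC (i + j.+1).+1 u.
  apply: LC_conj => //; rewrite addnS -addSn; apply: IH => //.
  by rewrite -invgR; apply: LCV; apply: LC_commH => //; apply: LCV.
have hv : LC (i + j.+1).+1 v.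
  apply: LC_conj => //; rewrite addnS; apply: LC_commH => //.
  by apply: IH => //; apply: LCV.
move=> /eqP; rewrite -mulgA mulg_eq1 => /eqP e.
have : LC (i + j.+1).+1 (([~ [~ y, k], g] ^ k^-1) ^ k).
  by apply: LC_conj => //; rewrite e; apply/LCV/LCM.
by rewrite -conjgM mulVg conjg1.
Qed.

End LowerCentral.

Lemma filt_lower_central (G : groupType) (a b x : G) m g :
  filt (abx_gens a b x) m g ->
  forall k, (k < m false + m true)%N -> lower_central (gen [set a; b; x]) k g.
Proof.
have subH := gen_subgroup [set a; b; x].
have pos n h : filt (abx_gens a b x) n h -> (0 < n false + n true)%N.
  by move=> /filt_nz [[] hj]; rewrite addn_gt0 hj ?orbT.
elim=> [j h hg|n nz|n h h' fh IHh fh' IHh'|n h fh IHh|n n' h h' fh IHh fh' IHh'|n n' h fh IH nz le] k hk.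
- have -> : k = 0%N by move: hk; rewrite /unitm; case: (j); rewrite !ltnS leqn0 => /eqP.
  by apply: sub_gen; case: j hg {hk} => /=; [move=> ->; right|case=> ->; left; [left|right]].
- exact: LC1.
- by apply: LCM => //; [apply: IHh | apply: IHh'].
- by apply: LCV => //; apply: IHh.
- have p1 := pos _ _ fh; have p2 := pos _ _ fh'.
  have := LC_comm subH (IHh (n false + n true).-1 _) (IHh' (n' false + n' true).-1 _).
  rewrite !prednK // => /(_ (leqnn _) (leqnn _)); apply: LC_le => //.
  by move: hk; rewrite /addm; lia.
- by apply: IH; apply: leq_trans hk _; apply: leq_add.
Qed.

(** The hypothesis excludes exact order [p]. A smaller positive exponent killing [y] would be prime
    to [p], and Bezout would give [y = 1]. *)
Lemma prime_to_group_pow (pi : seq nat) (G : groupType) p (y : G) :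
  prime_to_group pi G -> p \in pi -> prime p -> y ^+ p = 1 -> y = 1.
Proof.
move=> hG hp pr yp; apply: contrapT => y1; apply: (hG p y hp); split=> //.
  exact: prime_gt0.
move=> m /andP[m0 mp] ym; apply: y1.
have cop : coprime m p.
  by rewrite coprime_sym prime_coprime // gtnNdvd.
case: (egcdnP p m0) => km kn e _; move: cop; rewrite /coprime => /eqP cop.
have : y ^+ (km * m) = 1 by rewrite mulnC expgnA ym expg1n.
by rewrite e cop expgnDr mulnC expgnA yp expg1n mul1g expg1.
Qed.

Theorem theorem3p1 (G : groupType)
    (hG : prime_to_group [:: 2; 3; 5] G)
    (hnil : forall a b x : G, right_engel 4 G a -> right_engel 4 G b ->
       nilpotent_subgroup (gen [set a; b; x])) :
  is_subgroup (right_engel 4 G).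
Proof.
have torsion_free (y : G) k : y ^+ (30 ^ k) = 1 -> y = 1.
  elim: k => [|k IH]; first by rewrite expg1.
  rewrite expnSr expgnA => h; apply: IH; move: (y ^+ _) h => u.
  rewrite -[30%N]/(2 * 3 * 5)%N !expgnA => /(prime_to_group_pow hG) h5.
  by apply/(prime_to_group_pow hG (p := 2))/(prime_to_group_pow hG (p := 3))/h5.
(* Both [a * b] and [a^-1] have bidegree (1, 0), and four commutators with [x] raise it to (1, 4),
   so one statement covers both closure properties. *)
have deep a b x u : right_engel 4 G a -> right_engel 4 G b ->
    filt (abx_gens a b x) (unitm false) u -> engel_commutator u 4 x = 1.
  move=> ha hb hu; have [_ [c hc]] := hnil a b x ha hb.
  have fx : filt (abx_gens a b x) (unitm true) x by apply: filt_gen.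
  have f4 := filt_comm (filt_comm (filt_comm (filt_comm hu fx) fx) fx) fx.
  apply: (@deep_filt_trivial _ a b x _ torsion_free c _ _ _ f4) => //.
    by move=> g [->|->] h; [apply: ha | apply: hb].
  by move=> m g fg /(filt_lower_central fg); rewrite hc.
split=> [x|a b ha hb x|a ha x].
- by rewrite /engel_commutator /= !comm1g.
- by apply: (deep a b) => //; apply: filt_mul; apply: filt_gen; [left | right].
- by apply: (deep a a) => //; apply: filt_inv; apply: filt_gen; left.
Qed.
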